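(* Let $G$ be a profinite group and let $H \leq G$ be a closed subgroup which is accessible within $G$ via a graph of profinite groups $(\mathcal{G},\Xi,\Theta)$, where the finite connected graph $\Xi$ has $n$ edges. If $R$ is a finite ring whose characteristic does not divide the order of any edge group $\mathcal{G}(e)$, $e \in E(\Xi)$, then there exists a continuous derivation $f \colon G \to R[[G]]^n$ satisfying $\operatorname{Ker}(f) = H$.
   Context: A finite graph $\Xi$ is a finite set with a distinguished subset $V(\Xi)$ of vertices, edge set $E(\Xi) = \Xi \setminus V(\Xi)$, and maps $d_0,d_1 \colon \Xi \to V(\Xi)$ restricting to the identity on $V(\Xi)$ (initial and terminal vertex of an edge). A graph of profinite groups $(\mathcal{G},\Xi)$ over a finite connected graph $\Xi$ consists of profinite groups $\mathcal{G}(x)$ for $x \in \Xi$ (vertex and edge groups) and continuous injective homomorphisms $\partial_i \colon \mathcal{G}(e) \to \mathcal{G}(d_i(e))$ for $e \in E(\Xi)$, $i \in \{0,1\}$. Given a spanning tree $\Theta$ of $\Xi$ and stable letters $T=\{t_e : e \in E(\Xi)\}$, let $W$ be the free profinite product of all the vertex groups $\mathcal{G}(v)$, $v \in V(\Xi)$, and the free profinite group on $T$; let $N$ be the smallest closed normal subgroup of $W$ containing $\{t_e : e \in E(\Theta)\}$ and $\{\partial_1(g)^{-1}t_e^{-1}\partial_0(g)t_e : e \in E(\Xi),\ g \in \mathcal{G}(e)\}$. The profinite fundamental group is $\Pi_1(\mathcal{G},\Xi,\Theta) = W/N$. A vertex group $\mathcal{G}(v)$ is identified with its image in $\Pi_1(\mathcal{G},\Xi,\Theta)$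 under the canonical map. A closed subgroup $H \leq G$ is accessible within $G$ via $(\mathcal{G},\Xi,\Theta)$ if $G = \Pi_1(\mathcal{G},\Xi,\Theta)$, $\Xi$ is a finite (connected) graph, all edge groups $\mathcal{G}(e)$, $e \in E(\Xi)$, are finite, and there is a vertex $v \in V(\Xi)$ with $H = \mathcal{G}(v)$ (as subgroups of $G$). $R[[G]] = \varprojlim_U R[G/U]$, with $U$ ranging over the open normal subgroups of $G$, is the completed group algebra, regarded as a right $G$-module by right multiplication. A (right) derivation of $G$ in a right $G$-module $M$ is a map $f \colon G \to M$ with $f(gh) = f(g)h + f(h)$ for all $g,h \in G$; $\operatorname{Ker}(f) = \{g \in G : f(g) = 0\}$. *)

(* Defs.v *)
From HB Require Import structures.
(* fingroup comes first, so that Group and cycle are those of monoid and path. *)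
From mathcomp Require Import fingroup.
From mathcomp Require Import all_boot all_algebra finmap generic_quotient.
From mathcomp Require Import boolp classical_sets functions cardinality.
From mathcomp Require Import topology.
From mathcomp Require cyclic.

Set Implicit Arguments.
Unset Strict Implicit.
Unset Printing Implicit Defensive.

Import GRing.Theory.
Local Open Scope classical_set_scope.
Local Open Scope ring_scope.

HB.mixin Record isTopologicalGroup G of Group G & Topological G := {
  mulg_continuous : continuous (fun xy : G * G => (xy.1 * xy.2)%g);
  invg_continuous : continuous (fun x : G => x^-1%g)
}.

HB.structure Definition TopologicalGroup :=
  {G of isTopologicalGroup G & Group G & Topological G}.

HB.mixin Record isProfinite G of Topological G := {
  profinite_compact : compact [set: G];
  profinite_hausdorff : hausdorff_space G;
  profinite_totally_disconnected : totally_disconnected [set: G]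
}.

#[short(type="profiniteGroupType")]
HB.structure Definition ProfiniteGroup :=
  {G of isProfinite G & TopologicalGroup G}.

(* compact_cover is stated for pointed spaces; a group is pointed by 1. *)
Lemma profinite_cover_compact (G : profiniteGroupType) : cover_compact [set: G].
Proof.
pose P : ptopologicalType := HB.pack_for ptopologicalType G
  (isPointed.Build G (1%g : G)).
have := @profinite_compact G; have := @compact_cover P.
by rewrite /= => ->.
Qed.

Definition subgroup (G : groupType) (H : set G) : Prop :=
  [/\ H 1%g, forall x y, H x -> H y -> H (x * y)%g & forall x, H x -> H x^-1%g].

Definition normal_subgroup (G : groupType) (N : set G) : Prop :=
  subgroup N /\ forall x g, N x -> N (x ^ g)%g.

Definition continuous_hom (G K : profiniteGroupType) (f : G -> K) : Prop :=
  {morph f : x y / (x * y)%g} /\ continuous f.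

(* The order of a profinite group is only used when it is finite; for an
   infinite one this is the junk value 0. *)
Definition group_order (G : profiniteGroupType) : nat := #|` fset_set [set: G]|.

Definition closed_normal_closure (G : profiniteGroupType) (S : set G) : set G :=
  \bigcap_(N in [set N : set G | [/\ normal_subgroup N, closed N & S `<=` N]]) N.

Definition is_free_profinite_group (X : finType) (F : profiniteGroupType)
    (t : X -> F) : Prop :=
  forall (K : profiniteGroupType) (phi : X -> K),
    exists! psi : F -> K, continuous_hom psi /\ forall x, psi (t x) = phi x.

Definition is_free_profinite_product (I : finType) (A : I -> profiniteGroupType)
    (W : profiniteGroupType) (iota : forall i, A i -> W) : Prop :=
  (forall i, continuous_hom (iota i)) /\
  forall (K : profiniteGroupType) (phi : forall i, A i -> K),
    (forall i, continuous_hom (phi i)) ->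
    exists! psi : W -> K,
      continuous_hom psi /\ forall i a, psi (iota i a) = phi i a.

Record finGraph := FinGraph {
  graph_carrier :> finType;
  vertices : {set graph_carrier};
  d0 : graph_carrier -> {x | x \in vertices};
  d1 : graph_carrier -> {x | x \in vertices};
  d0_vertex : forall v : {x | x \in vertices}, d0 (val v) = v;
  d1_vertex : forall v : {x | x \in vertices}, d1 (val v) = v
}.

Definition edges (Xi : finGraph) : {set Xi} := ~: vertices Xi.
Definition vertex (Xi : finGraph) : finType := {x | x \in vertices Xi}.
Definition edge (Xi : finGraph) : finType := {x | x \in edges Xi}.

Section Graphs.
Variable Xi : finGraph.
Implicit Types S : {set Xi}.

Definition adjacent S : rel (vertex Xi) := fun u v =>
  [exists e : edge Xi, (val e \in S) &&
    (((d0 (val e) == u) && (d1 (val e) == v))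
     || ((d0 (val e) == v) && (d1 (val e) == u)))].

(* Connectedness of the graph with all the vertices of Xi and those edges of Xi
   which are in S. *)
Definition connected_on S : Prop :=
  (0 < #|vertices Xi|)%N /\ forall u v : vertex Xi, connect (adjacent S) u v.

Definition connected_graph : Prop := connected_on [set: Xi]%SET.

(* An oriented edge (e, b) runs from d0 e to d1 e when b is false, and from
   d1 e to d0 e when b is true. *)
Definition oedge : Type := (edge Xi * bool)%type.
Definition origin (o : oedge) : vertex Xi :=
  if o.2 then d1 (val o.1) else d0 (val o.1).
Definition target (o : oedge) : vertex Xi :=
  if o.2 then d0 (val o.1) else d1 (val o.1).
Definition orev (o : oedge) : oedge := (o.1, ~~ o.2).

(* A circuit: a nonempty closed path without backtracking and without repeated
   vertices. Loops and pairs of parallel edges give circuits of length 1 and 2. *)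
Definition circuit (s : seq oedge) : bool :=
  [&& s != [::],
      cycle (fun o o' => (target o == origin o') && (o' != orev o)) s
    & uniq (map origin s)].

Definition spanning_tree (Theta : {set Xi}) : Prop :=
  [/\ vertices Xi \subset Theta,
      connected_on Theta
    & forall s, circuit s -> ~~ all (fun o => val o.1 \in Theta) s].

End Graphs.

Record graphOfProfiniteGroups (Xi : finGraph) := GraphOfProfiniteGroups {
  gg :> Xi -> profiniteGroupType;
  bd0 : forall e : edge Xi, gg (val e) -> gg (val (d0 (val e)));
  bd1 : forall e : edge Xi, gg (val e) -> gg (val (d1 (val e)));
  bd0_hom : forall e, continuous_hom (@bd0 e);
  bd1_hom : forall e, continuous_hom (@bd1 e);
  bd0_inj : forall e, injective (@bd0 e);
  bd1_inj : forall e, injective (@bd1 e)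
}.

Section FundamentalGroup.
Variables (Xi : finGraph) (GG : graphOfProfiniteGroups Xi) (Theta : {set Xi}).

(* The free factors of W: the vertex groups (indices Some v) and the free
   profinite group on the stable letters (index None). *)
Definition free_factor (F : profiniteGroupType) (i : option (vertex Xi)) :
    profiniteGroupType :=
  if i is Some v then GG (val v) else F.

Section Relators.
Variables (F : profiniteGroupType) (t : edge Xi -> F) (W : profiniteGroupType).
Variable iota : forall i : option (vertex Xi), free_factor F i -> W.

Definition stable (e : edge Xi) : W := @iota None (t e).

Definition edge_relator (e : edge Xi) (g : GG (val e)) : W :=
  ((@iota (Some (d1 (val e))) (bd1 g))^-1 * (stable e)^-1
   * @iota (Some (d0 (val e))) (bd0 g) * stable e)%g.

Definition relators : set W :=
  [set stable e | e in [set e | val e \in Theta]] `|`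
  \bigcup_(e : edge Xi) range (@edge_relator e).

End Relators.

(* G is the fundamental group Pi_1(GG, Xi, Theta), with canonical maps
   nu v : GG v -> G. The quotient W / N is given by a continuous surjective
   homomorphism with kernel N, which by compactness is a topological quotient. *)
Definition is_fundamental_group (G : profiniteGroupType)
    (nu : forall v : vertex Xi, GG (val v) -> G) : Prop :=
  exists (F : profiniteGroupType) (t : edge Xi -> F) (W : profiniteGroupType)
         (iota : forall i : option (vertex Xi), free_factor F i -> W)
         (p : W -> G),
    [/\ is_free_profinite_group t,
        is_free_profinite_product iota,
        [/\ continuous_hom p, set_surj [set: W] [set: G] p
          & [set w | p w = 1%g] = closed_normal_closure (relators t iota)]
      & forall v g, nu v g = p (@iota (Some v) g)].

Definition accessible_via (G : profiniteGroupType) (H : set G) : Prop :=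
  [/\ connected_graph Xi, spanning_tree Theta,
      forall e : edge Xi, finite_set [set: GG (val e)]
    & exists2 nu : forall v : vertex Xi, GG (val v) -> G,
        is_fundamental_group nu & exists v, H = range (nu v)].

End FundamentalGroup.

Record openNormal (G : profiniteGroupType) := OpenNormal {
  open_normal_set :> set G;
  open_normal_open : open open_normal_set;
  open_normal_normal : normal_subgroup open_normal_set
}.
HB.instance Definition _ (G : profiniteGroupType) := gen_eqMixin (openNormal G).
HB.instance Definition _ (G : profiniteGroupType) :=
  gen_choiceMixin (openNormal G).

Local Open Scope quotient_scope.

Section QuotientGroup.
Variables (G : profiniteGroupType) (U : openNormal G).
Local Notation US := (open_normal_set U).

Let U1 : US 1%g. Proof. by have [[]] := open_normal_normal U. Qed.
Let UM x y : US x -> US y -> US (x * y)%g.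
Proof. by have [[_ h _] _] := open_normal_normal U; exact: h. Qed.
Let UV x : US x -> US x^-1%g.
Proof. by have [[_ _ h] _] := open_normal_normal U; exact: h. Qed.
Let UJ x g : US x -> US (x ^ g)%g.
Proof. by have [_ h] := open_normal_normal U; exact: h. Qed.

Definition same_coset : rel G := fun x y => `[< US (x^-1 * y)%g >].

Lemma same_coset_refl : reflexive same_coset.
Proof. by move=> x; apply/asboolP; rewrite mulVg. Qed.

Lemma same_coset_sym : symmetric same_coset.
Proof.
by move=> x y; apply/asboolP/asboolP => /UV; rewrite invgM invgK.
Qed.

Lemma same_coset_trans : transitive same_coset.
Proof.
move=> y x z /asboolP xy /asboolP yz; apply/asboolP.
by have := UM xy yz; rewrite mulgA mulgK.
Qed.

Canonical same_coset_equiv :=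
  EquivRel same_coset same_coset_refl same_coset_sym same_coset_trans.

Definition quot : Type := {eq_quot same_coset_equiv}.
HB.instance Definition _ := Choice.on quot.
HB.instance Definition _ := EqQuotient.on quot.

Definition quot_one : quot := \pi_quot 1%g.
Definition quot_mul (a b : quot) : quot := \pi_quot (repr a * repr b)%g.
Definition quot_inv (a : quot) : quot := \pi_quot (repr a)^-1%g.

Lemma quot_eqP (x y : G) : \pi_quot x = \pi_quot y <-> US (x^-1 * y)%g.
Proof.
split; first by move=> /eqP; rewrite (eqmodE same_coset_equiv) => /asboolP.
by move=> ?; apply/eqP; rewrite (eqmodE same_coset_equiv); exact/asboolP.
Qed.

Lemma quot_ind (P : quot -> Prop) : (forall x, P (\pi_quot x)) -> forall a, P a.
Proof. by move=> h a; rewrite -[a]reprK; exact: h. Qed.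

Lemma quot_mul_pi x y : quot_mul (\pi_quot x) (\pi_quot y) = \pi_quot (x * y)%g.
Proof.
have ex : US ((repr (\pi_quot x))^-1 * x)%g by apply/quot_eqP; rewrite reprK.
have ey : US ((repr (\pi_quot y))^-1 * y)%g by apply/quot_eqP; rewrite reprK.
apply/quot_eqP; have := UM (UJ (repr (\pi_quot y)) ex) ey.
by rewrite /conjg invgM !mulgA mulgK.
Qed.

Lemma quot_inv_pi x : quot_inv (\pi_quot x) = \pi_quot x^-1%g.
Proof.
have ex : US ((repr (\pi_quot x))^-1 * x)%g by apply/quot_eqP; rewrite reprK.
by apply/quot_eqP; have := UV (UJ x^-1%g ex); rewrite /conjg !(invgK, invgM, mulgA) mulgV mul1g.
Qed.

Lemma quot_mulA : associative quot_mul.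
Proof.
elim/quot_ind=> x; elim/quot_ind=> y; elim/quot_ind=> z.
by rewrite !quot_mul_pi mulgA.
Qed.
Lemma quot_mul1 : left_id quot_one quot_mul.
Proof. by elim/quot_ind=> x; rewrite [LHS]quot_mul_pi mul1g. Qed.
Lemma quot_1mul : right_id quot_one quot_mul.
Proof. by elim/quot_ind=> x; rewrite [LHS]quot_mul_pi mulg1. Qed.
Lemma quot_mulV : left_inverse quot_one quot_inv quot_mul.
Proof. by elim/quot_ind=> x; rewrite quot_inv_pi quot_mul_pi mulVg. Qed.
Lemma quot_Vmul : right_inverse quot_one quot_inv quot_mul.
Proof. by elim/quot_ind=> x; rewrite quot_inv_pi quot_mul_pi mulgV. Qed.

HB.instance Definition _ :=
  isGroup.Build quot quot_mulA quot_mul1 quot_1mul quot_mulV quot_Vmul.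

(* G/U is finite, because G is compact and U is open. *)
Lemma quot_finite : finite_set [set: quot].
Proof.
have op (a : quot) : open [set x : G | US ((repr a)^-1 * x)%g].
  apply: (@open_comp G G (fun x => (repr a)^-1 * x)%g); last first.
    exact: open_normal_open.
  move=> x _; apply: (@continuous_comp _ _ _
    (fun x => ((repr a)^-1%g, x)) (fun z : G * G => (z.1 * z.2)%g)).
    by apply: cvg_pair => /=; [exact: cvg_cst|exact: cvg_id].
  exact: mulg_continuous.
have [x _|D _ cov] := @profinite_cover_compact G quot setT _ (fun a _ => op a).
  by exists (\pi_quot x) => //=; apply/quot_eqP; rewrite reprK.
apply: (@sub_finite_set _ _ [set` D]) => //.
elim/quot_ind=> x _; have [a aD /=] := cov x I.
by move=> /quot_eqP; rewrite reprK => <-.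
Qed.

Definition quot_enum : seq quot := fset_set [set: quot].

Lemma quot_enumE x : x \in quot_enum.
Proof. by rewrite in_fset_set ?inE//; exact: quot_finite. Qed.

Lemma quot_enumP : Finite.axiom quot_enum.
Proof.
by apply: Finite.uniq_enumP => [|x]; [exact: fset_uniq|rewrite quot_enumE].
Qed.

Lemma quot_pickleK :
  pcancel (fun x : quot => index x quot_enum) (onth quot_enum).
Proof.
move=> x; rewrite onthE (nth_map x) ?index_mem ?quot_enumE//.
by rewrite nth_index ?quot_enumE.
Qed.

HB.instance Definition _ := PCanIsCountable quot_pickleK.
HB.instance Definition _ := isFinite.Build quot quot_enumP.

Definition quot_pi (x : G) : quot := \pi_quot x.

Lemma quot_piM : {morph quot_pi : x y / (x * y)%g}.
Proof. by move=> x y; rewrite /quot_pi -quot_mul_pi. Qed.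

End QuotientGroup.

(* The projection G/U -> G/V, to be used when U is contained in V. *)
Definition quot_proj (G : profiniteGroupType) (U V : openNormal G)
  (x : quot U) : quot V := quot_pi V (repr x).

Lemma quot_projE (G : profiniteGroupType) (U V : openNormal G) (g : G) :
  U `<=` V -> quot_proj V (quot_pi U g) = quot_pi V g.
Proof.
move=> UV; apply/quot_eqP/UV/quot_eqP.
by rewrite reprK.
Qed.

Lemma quot_projM (G : profiniteGroupType) (U V : openNormal G) :
  U `<=` V -> {morph @quot_proj G U V : x y / (x * y)%g}.
Proof.
move=> UV; elim/quot_ind=> x; elim/quot_ind=> y.
by rewrite -[(_ * _)%g](quot_piM U x y) !quot_projE// quot_piM.
Qed.

(* R[Q]: the function a stands for the sum of the a x * x. *)
Definition group_algebra (R : finPzRingType) (Q : finGroupType) : Type :=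
  {ffun Q -> R}.
HB.instance Definition _ (R : finPzRingType) (Q : finGroupType) :=
  GRing.Zmodule.on (group_algebra R Q).

Section GroupAlgebra.
Variables (R : finPzRingType) (Q : finGroupType).

(* Right multiplication by q: the coefficient of x in (sum_y a y * y) q is
   a (x q^-1). *)
Definition galg_mulr (a : group_algebra R Q) (q : Q) : group_algebra R Q :=
  [ffun x => a (x * q^-1)%g].

(* The map R[Q] -> R[Q'] induced by a homomorphism h. *)
Definition galg_map (Q' : finGroupType) (h : Q -> Q') (a : group_algebra R Q) :
    group_algebra R Q' :=
  [ffun y => \sum_(x | h x == y) a x].

Lemma galg_mulrD a b q :
  galg_mulr (a + b) q = galg_mulr a q + galg_mulr b q.
Proof. by apply/ffunP => x; rewrite !ffunE. Qed.

Lemma galg_mulr1 a : galg_mulr a 1%g = a.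
Proof. by apply/ffunP => x; rewrite ffunE invg1 mulg1. Qed.

Lemma galg_mulrM a q r : galg_mulr a (q * r)%g = galg_mulr (galg_mulr a q) r.
Proof. by apply/ffunP => x; rewrite !ffunE invgM mulgA. Qed.

Lemma galg_map0 (Q' : finGroupType) (h : Q -> Q') : galg_map h 0 = 0.
Proof. by apply/ffunP => y; rewrite !ffunE big1 // => x _; rewrite ffunE. Qed.

Lemma galg_mapD (Q' : finGroupType) (h : Q -> Q') a b :
  galg_map h (a + b) = galg_map h a + galg_map h b.
Proof.
apply/ffunP => y; rewrite !ffunE -big_split /=.
by apply: eq_bigr => x _; rewrite ffunE.
Qed.

Lemma galg_mapN (Q' : finGroupType) (h : Q -> Q') a :
  galg_map h (- a) = - galg_map h a.
Proof.
apply/ffunP => y; rewrite !ffunE -sumrN.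
by apply: eq_bigr => x _; rewrite ffunE.
Qed.

End GroupAlgebra.

Lemma galg_map_mulr (R : finPzRingType) (Q Q' : finGroupType) (h : Q -> Q')
    (a : group_algebra R Q) q :
  {morph h : x y / (x * y)%g} ->
  galg_map h (galg_mulr a q) = galg_mulr (galg_map h a) (h q).
Proof.
move=> hM; apply/ffunP => y; rewrite !ffunE.
rewrite (reindex_inj (mulIg q)); apply: eq_big => [x|x _].
  by rewrite hM; apply/eqP/eqP => [<-|->]; rewrite ?mulgK ?mulgVK.
by rewrite ffunE mulgK.
Qed.


Section CompletedGroupAlgebra.
Variables (R : finPzRingType) (G : profiniteGroupType).

Definition galg_prod : Type :=
  prod_topology (fun U : openNormal G =>
    discrete_topology (group_algebra R (quot U))).
HB.instance Definition _ := Topological.on galg_prod.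

Definition galg_coherent : set galg_prod :=
  [set x | forall U V : openNormal G, U `<=` V ->
     galg_map (@quot_proj G U V) (x U) = x V].

(* R[[G]], the inverse limit of the discrete groups R[G/U]. *)
Definition completed_group_algebra : Type := set_type galg_coherent.
HB.instance Definition _ := Topological.on completed_group_algebra.

Definition cga_coef (x : completed_group_algebra) (U : openNormal G) :
  group_algebra R (quot U) := val x U.

Lemma cga_coef_coherent x (U V : openNormal G) : U `<=` V ->
  galg_map (@quot_proj G U V) (cga_coef x U) = cga_coef x V.
Proof. by move=> UV; have /set_mem := valP x; apply. Qed.

Lemma cga_coef_inj x y : (forall U, cga_coef x U = cga_coef y U) -> x = y.
Proof. by move=> h; apply/val_inj/functional_extensionality_dep. Qed.

Definition cga_of (x : forall U, group_algebra R (quot U))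
    (cx : forall U V : openNormal G, U `<=` V ->
      galg_map (@quot_proj G U V) (x U) = x V) : completed_group_algebra :=
  exist _ (x : galg_prod) (mem_set cx).

Fact cga_zero_subproof (U V : openNormal G) : U `<=` V ->
  galg_map (@quot_proj G U V) 0 = 0 :> group_algebra R (quot V).
Proof. by move=> _; exact: galg_map0. Qed.

Fact cga_opp_subproof x (U V : openNormal G) : U `<=` V ->
  galg_map (@quot_proj G U V) (- cga_coef x U) = - cga_coef x V.
Proof. by move=> UV; rewrite galg_mapN cga_coef_coherent. Qed.

Fact cga_add_subproof x y (U V : openNormal G) : U `<=` V ->
  galg_map (@quot_proj G U V) (cga_coef x U + cga_coef y U)
  = cga_coef x V + cga_coef y V.
Proof. by move=> UV; rewrite galg_mapD !cga_coef_coherent. Qed.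

Fact cga_mulr_subproof x (g : G) (U V : openNormal G) : U `<=` V ->
  galg_map (@quot_proj G U V) (galg_mulr (cga_coef x U) (quot_pi U g))
  = galg_mulr (cga_coef x V) (quot_pi V g).
Proof.
move=> UV; rewrite galg_map_mulr ?quot_projE ?cga_coef_coherent//.
exact: quot_projM.
Qed.

Definition cga_zero : completed_group_algebra := cga_of cga_zero_subproof.
Definition cga_opp x : completed_group_algebra := cga_of (cga_opp_subproof x).
Definition cga_add x y : completed_group_algebra :=
  cga_of (cga_add_subproof x y).

Lemma cga_addA : associative cga_add.
Proof. by move=> x y z; apply: cga_coef_inj => U; exact: addrA. Qed.
Lemma cga_addC : commutative cga_add.
Proof. by move=> x y; apply: cga_coef_inj => U; exact: addrC. Qed.
Lemma cga_add0 : left_id cga_zero cga_add.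
Proof. by move=> x; apply: cga_coef_inj => U; exact: add0r. Qed.
Lemma cga_addN : left_inverse cga_zero cga_opp cga_add.
Proof. by move=> x; apply: cga_coef_inj => U; exact: addNr. Qed.

HB.instance Definition _ := GRing.isZmodule.Build completed_group_algebra
  cga_addA cga_addC cga_add0 cga_addN.

(* The product of x with the image of g in R[[G]]. *)
Definition cga_mulr x (g : G) : completed_group_algebra :=
  cga_of (cga_mulr_subproof x g).

Lemma cga_mulrD x y g : cga_mulr (x + y) g = cga_mulr x g + cga_mulr y g.
Proof. by apply: cga_coef_inj => U; exact: galg_mulrD. Qed.

Lemma cga_mulr1 x : cga_mulr x 1%g = x.
Proof. by apply: cga_coef_inj => U; exact: galg_mulr1. Qed.

Lemma cga_mulrM x g h : cga_mulr x (g * h)%g = cga_mulr (cga_mulr x g) h.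
Proof.
by apply: cga_coef_inj => U; rewrite /cga_coef /= quot_piM galg_mulrM.
Qed.

End CompletedGroupAlgebra.

Definition cga_row_mulr (R : finPzRingType) (G : profiniteGroupType) (n : nat)
    (x : 'rV[completed_group_algebra R G]_n) (g : G) :
    'rV[completed_group_algebra R G]_n :=
  map_mx (fun y => cga_mulr y g) x.

Definition derivation (G : groupType) (M : zmodType) (act : M -> G -> M)
    (f : G -> M) : Prop :=
  forall g h : G, f (g * h)%g = act (f g) h + f h.

Definition derivation_ker (G : groupType) (M : zmodType) (f : G -> M) : set G :=
  [set g | f g = 0].

(* The order is that of 1 in the additive group of R, as fingroup's group law on
   a finZmodType is its addition. *)
Definition characteristic (R : finPzRingType) : nat :=
  @fingroup.order (R : finZmodType) 1%R.

Lemma dvdn_characteristic (R : finPzRingType) m :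
  (characteristic R %| m)%N = (m%:R == 0 :> R).
Proof. by rewrite /characteristic cyclic.order_dvdn FinRing.zmodXgE. Qed.

(* Main.v *)
(* Write T for the spanning tree, t_e for the stable letters, v for the vertex
   with H = G(v), and E_e for the image of an edge group in G. A continuous
   derivation f of G in a finite module is determined by, and can be prescribed
   on, the vertex groups and the t_e. Take f(g) = x_u (g - 1) on G(u) and
   f(t_e) = x_{d0 e} t_e - x_{d1 e} + y_e, where y_e is fixed by E_e; since
   f(t_e) = 0 for e in T, the x_u with x_v = 0 form the potential on T with
   differences y_e. With y_e the sum of the elements of E_e, placed in the
   coordinate e, these derivations into the R[G/U]^n are compatible, and they
   vanish on H because x_v = 0.
   If g is not in H, choose U with U meeting each E_e trivially and g not in HU.
   With Q = G/U, the submodule of R[Q] generated by y_e is then R[E_e\Q], which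
   is mapped to the sum of the R[G(u)\Q] by E_e |-> G(d0 e) t_e - G(d1 e). The
   composite of f with this map takes the value G(v) g - G(v) at g, since it
   does so on generators. This is nonzero as soon as R is. *)
Require Import Defs.
From HB Require Import structures.
From mathcomp Require Import fingroup.
From mathcomp Require Import all_boot all_algebra finmap.
From mathcomp Require Import boolp classical_sets functions cardinality.
From mathcomp Require Import topology.

Set Implicit Arguments.
Unset Strict Implicit.
Unset Printing Implicit Defensive.

Import GRing.Theory.
Local Open Scope classical_set_scope.
Local Open Scope ring_scope.

(** * Open normal subgroups of profinite groups *)

(** Clopen neighbourhoods of [x] are stable under finite intersection, and each point outside [U] is
    missed by one of them; compactness of the complement of [U] gives one that misses all such
    points. *)
Lemma directed_clopen_compl_compact (T : topologicalType) (x : T) (U : set T) :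
  compact [set: T] -> open U ->
  \bigcap_(C in [set C : set T | clopen C /\ C x]) C `<=` U ->
  exists C : set T, [/\ clopen C, C x & C `<=` U].
Proof.
move=> cT oU QU.
pose F := filter_from [set D : set T | clopen D /\ D x] id.
have FF : Filter F.
  apply: filter_from_filter; first by exists setT; split => //; exact: clopenT.
  by move=> A B [? ?] [? ?]; exists (A `&` B) => //; split=> //; exact: clopenI.
have PF : ProperFilter F by apply: filter_from_proper; move=> ? [_ ?]; exists x.
have /(iffLR (compact_near_coveringP _)) : compact (~` U).
  by apply: (subclosed_compact _ cT) => //; exact: open_closedC.
move=> /(_ _ _ setC (powerset_filter_from_filter PF))[].
  move=> y nUy; have : ~ (forall C, clopen C /\ C x -> C y).
    by move=> h; apply: nUy; apply: QU.
  move=> /existsNP [C /not_implyP [[cC Cx] nCy]].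
  exists (~` C, [set V | V `<=` C]); first split.
  - apply: open_nbhs_nbhs; split => //; apply: closed_openC.
    by case: cC.
  - apply/near_powerset_filter_fromP; first by move=> ? ?; exact: subset_trans.
    by exists C => //; exists C.
  - by case=> i j [? /subsetC]; apply.
move=> D [DF _ [C DC]] /(_ _ DC) /subsetC2 CU.
have [E [cE Ex] EC] := DF _ DC.
by exists E; split => //; exact: subset_trans CU.
Qed.

Lemma quasicomponent_connected (T : topologicalType) (x : T) :
  compact [set: T] -> hausdorff_space T ->
  connected (\bigcap_(C in [set C : set T | clopen C /\ C x]) C).
Proof.
move=> cT hT; set Q := \bigcap_(C in _) C.
have Qx : Q x by move=> C [].
have cQ : closed Q by apply: closed_bigI => C [[]].
(* A closed A and its closed complement B in Q are separated by open sets V and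
   W; a clopen neighbourhood C of x inside V u W meets V in a clopen set. *)
suff key (A B : set T) : closed A -> closed B -> A `&` B = set0 ->
    A `|` B = Q -> A x -> B = set0.
  move=> A A0 [C oC AC] [D cD AD].
  have cA : closed A by rewrite AD; exact: closedI.
  pose B := Q `&` ~` C.
  have cB : closed B by apply: closedI => //; exact: open_closedC.
  have AB0 : A `&` B = set0.
    by rewrite AC /B; apply/seteqP; split => // z [[? ?] [_ ?]].
  have AUB : A `|` B = Q.
    by rewrite AC /B -setIUr setUv setIT.
  have [Ax|nAx] := pselect (A x).
    by rewrite -AUB (key A B) // setU0.
  have Bx : B x by move: Qx; rewrite -AUB => -[].
  move: A0; rewrite (key B A) //; first by case.
  - by rewrite setIC.
  - by rewrite setUC.
move=> cA cB AB0 AUB Ax.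
have [|V snV VB] := @compact_normal T hT cT A cA (~` B) _.
  move=> z /= Az; apply: open_nbhs_nbhs; split; first exact: closed_openC.
  by move=> Bz; have : (A `&` B) z by []; rewrite AB0.
pose O := V°; pose W := ~` closure V.
have OW0 z : O z -> W z -> False.
  by move=> /interior_subset/subset_closure Vz; apply.
have [||C [[oC cC] Cx COW]] :=
    @directed_clopen_compl_compact T x (O `|` W) cT _ _.
- apply: openU; first exact: open_interior.
  exact/closed_openC/closed_closure.
- rewrite -/Q -AUB => z [Az|Bz]; first by left; apply: snV.
  by right => /VB.
have Ox : O x by exact: snV.
have QO : Q `<=` O.
  move=> z Qz; suff [] : (C `&` O) z by [].
  apply: Qz; split => //; split.
    by apply: openI => //; exact: open_interior.
  have -> : C `&` O = C `&` closure V.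
    apply/seteqP; split => y [Cy]; first by move=> /interior_subset/subset_closure.
    by move=> Vy; split => //; have [|/(_ Vy)] := COW _ Cy.
  by apply: closedI => //; exact: closed_closure.
apply/seteqP; split => // z Bz.
have Oz : O z by apply: QO; rewrite -AUB; right.
by apply: (VB z) => //; apply: subset_closure; exact: interior_subset.
Qed.

(** The quasicomponent of [x] is connected, hence reduced to [x], so the clopen neighbourhoods of
    [x] shrink into any open one. *)
Lemma clopen_base (T : topologicalType) (x : T) (U : set T) :
  compact [set: T] -> hausdorff_space T -> totally_disconnected [set: T] ->
  nbhs x U -> exists C : set T, [/\ clopen C, C x & C `<=` U].
Proof.
move=> cT hT tT; rewrite nbhsE => -[V [oV Vx] VU].
have [|C [? ? CV]] := @directed_clopen_compl_compact T x V cT oV.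
  move=> z Qz; suff -> : z = x by [].
  suff : connected_component [set: T] x z by rewrite tT.
  exists (\bigcap_(C in [set C : set T | clopen C /\ C x]) C) => //.
  by split; [move=> C []|by []|exact: quasicomponent_connected].
by exists C; split => //; exact: subset_trans VU.
Qed.

Section ProfiniteGroup.
Variable G : profiniteGroupType.

Lemma mul_continuous2 (T : topologicalType) (f g : T -> G) :
  continuous f -> continuous g -> continuous (fun x => (f x * g x)%g).
Proof.
move=> cf cg x; apply: (@continuous_comp _ _ _ (fun x => (f x, g x))
  (fun z : G * G => (z.1 * z.2)%g)); last exact: mulg_continuous.
by apply: cvg_pair; [exact: cf|exact: cg].
Qed.

Lemma open_subgroup (N : set G) : subgroup N -> nbhs 1%g N -> open N.
Proof.
move=> [N1 NM NV] nN; rewrite openE => x Nx; rewrite /interior.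
have c : continuous (fun y : G => (x^-1 * y)%g).
  by apply: mul_continuous2; [move=> ?; exact: cvg_cst|move=> ?; exact: cvg_id].
have : nbhs x ((fun y : G => (x^-1 * y)%g) @^-1` N).
  by apply: c; rewrite mulVg.
by apply: filterS => y /= /(NM _ _ Nx); rewrite mulgA mulgV mul1g.
Qed.

(* N is the set of the x which can be inserted into any product without changing
   whether it is in C; it is open by compactness of G * G. *)
Lemma open_normal_base (A : set G) : nbhs 1%g A ->
  exists U : openNormal G, U `<=` A.
Proof.
move=> nA.
have [C [[oC cC] C1 CA]] := clopen_base (@profinite_compact G)
  (@profinite_hausdorff G) (@profinite_totally_disconnected G) nA.
pose N := [set x : G | forall ab : G * G, C (ab.1 * ab.2)%g <-> C (ab.1 * x * ab.2)%g].
have sN : normal_subgroup N.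
  split; first split.
  - by move=> ab; rewrite mulg1.
  - move=> x y Nx Ny ab; rewrite (Nx ab).
    by rewrite (Ny (ab.1 * x, ab.2)%g) /= !mulgA.
  - move=> x Nx ab; rewrite (Nx (ab.1 * x^-1, ab.2)%g) /=.
    by rewrite mulgVK.
  - move=> x g Nx ab; have := Nx (ab.1 * g^-1, g * ab.2)%g.
    by rewrite /= /conjg !mulgA mulgVK.
have nN : nbhs 1%g N.
  have cGG : compact [set: G * G].
    by rewrite -setXTT; apply: compact_setX; exact: profinite_compact.
  have /= := (iffLR (compact_near_coveringP _)) cGG G (nbhs 1%g)
    (fun x ab => C (ab.1 * ab.2)%g <-> C (ab.1 * x * ab.2)%g) _ _.
  have h : forall z : G * G, [set: G * G] z ->
      \forall ab \near z & x \near (1%g : G),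
      C (ab.1 * ab.2)%g <-> C (ab.1 * x * ab.2)%g.
    move=> [a b] _.
    pose m (w : (G * G) * G) := (w.1.1 * w.1.2)%g.
    pose m' (w : (G * G) * G) := (w.1.1 * w.2 * w.1.2)%g.
    have c1 : continuous (fun w : (G * G) * G => w.1.1).
      by move=> w; apply: (@continuous_comp _ _ _ fst fst); apply: cvg_fst.
    have c2 : continuous (fun w : (G * G) * G => w.1.2).
      by move=> w; apply: (@continuous_comp _ _ _ fst snd); [exact: cvg_fst|exact: cvg_snd].
    have c3 : continuous (fun w : (G * G) * G => w.2).
      by move=> w; exact: cvg_snd.
    have cm : continuous m by exact: mul_continuous2.
    have cm' : continuous m' by do 2!apply: mul_continuous2 => //.
    (* Since [m] and [m'] agree at this point and both [C] and its complement are open, nearby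
       values of [m] and [m'] are on the same side of [C]. *)
    have e : m' (a, b, 1%g) = m (a, b, 1%g) by rewrite /m' /m /= mulg1.
    have [Cab|nCab] := pselect (C (a * b)%g).
      have n1 : nbhs ((a, b), 1%g) (m @^-1` C).
        by apply: cm; apply: open_nbhs_nbhs.
      have n2 : nbhs ((a, b), 1%g) (m' @^-1` C).
        by apply: cm'; rewrite e; apply: open_nbhs_nbhs.
      by apply: filterS (filterI n1 n2) => -[[? ?] ?] [].
    have onC : open (~` C) by exact: closed_openC.
    have n1 : nbhs ((a, b), 1%g) (m @^-1` (~` C)).
      by apply: cm; apply: open_nbhs_nbhs.
    have n2 : nbhs ((a, b), 1%g) (m' @^-1` (~` C)).
      by apply: cm'; rewrite e; apply: open_nbhs_nbhs.
    by apply: filterS (filterI n1 n2) => -[[? ?] ?] [].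
  move=> /(_ _ h); apply: filterS => x Nx ab.
  exact: Nx.
exists (OpenNormal (open_subgroup (proj1 sN) nN) sN) => x /= Nx.
by apply: CA; have := Nx (1, 1)%g; rewrite /= !mul1g mulg1 => -[+ _]; apply.
Qed.

End ProfiniteGroup.

(** * Potentials on forests *)

Section Potentials.
Variable Xi : finGraph.
Implicit Types (S Theta : {set Xi}) (M : zmodType).

Lemma adjacent_sym S : symmetric (adjacent S).
Proof.
move=> u v; apply/eq_existsb => e; congr (_ && _).
by rewrite orbC.
Qed.

Lemma adjacent_edge S (e : edge Xi) : val e \in S ->
  adjacent S (d0 (val e)) (d1 (val e)).
Proof. by move=> eS; apply/existsP; exists e; rewrite eS !eqxx. Qed.

Lemma adjacentP S (u v : vertex Xi) : adjacent S u v ->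
  exists o : oedge Xi, [/\ val o.1 \in S, origin o = u & target o = v].
Proof.
move=> /existsP[e /andP[eS /orP[]/andP[/eqP h0 /eqP h1]]].
  by exists (e, false).
by exists (e, true).
Qed.

Local Notation nonbacktracking :=
  (fun o o' : oedge Xi => (target o == origin o') && (o' != orev o)).

Lemma adjacent_path_lift S (u : vertex Xi) p (o : oedge Xi) :
    path (adjacent S) u p -> uniq (u :: p) -> target o = u ->
    (origin o \notin p) || (val o.1 \notin S) ->
  exists s, [/\ path nonbacktracking o s, all (fun o => val o.1 \in S) s,
    map (@origin Xi) s = belast u p & target (last o s) = last u p].
Proof.
elim: p u o => [|v p IH] u o /=; first by exists [::].
move=> /andP[/adjacentP[o' [o'S o'u o'v]] vp] /andP[unp uvp] ou oS.
have uNp : u \notin p by apply: contra unp; rewrite inE orbC => ->.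
have [|s [? ? so ?]] := IH v o' vp uvp o'v; first by rewrite o'u uNp.
exists (o' :: s) => /=; split=> //; last by rewrite o'u so.
- rewrite ou o'u eqxx; apply/andP; split=> //; apply/eqP => e.
  move: oS o'S; rewrite -o'v e inE negb_or /orev /origin /target /=.
  by case: (o.2) => /=; rewrite eqxx //= => /negP h /h.
- by rewrite o'S.
Qed.

(** A simple path joining the ends of [e] without using [e] would lift to edges and close up with
    [e] to a circuit in [Theta]. *)
Lemma forest_separates Theta (e : edge Xi) :
    (forall s, circuit s -> ~~ all (fun o : oedge Xi => val o.1 \in Theta) s) ->
    val e \in Theta ->
  ~~ connect (adjacent (Theta :\ val e)) (d1 (val e)) (d0 (val e)).
Proof.
move=> acyc eT; apply/negP => /connectP[p0 + +].
move=> /shortenP[p vp up _] {p0} dp.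
have [|s [ps sT so sl]] := adjacent_path_lift (o := (e, false)) vp up erefl.
  by rewrite /= !inE eqxx orbT.
suff /acyc/negP[] : circuit ((e, false) :: s).
  rewrite /= eT; apply: sub_all sT => o /=.
  by rewrite inE => /andP[].
rewrite /circuit /= rcons_path ps sl -dp eqxx /=; apply/andP; split.
  (* The circuit closes without backtracking: the last edge of [s] differs from [e], and if [s] is
     empty then [e] is a loop, which is not its own reverse. *)
  case/lastP: s sT {ps so sl} => [_|s o]; first by apply/eqP => -[].
  rewrite all_rcons last_rcons => /andP[oT _].
  apply/eqP => -[ee _]; move: oT.
  by rewrite -ee !inE eqxx.
rewrite so -[origin _](_ : last (d1 (val e)) p = _); last by rewrite -dp.
by move: up; rewrite lastI rcons_uniq.
Qed.

(** Induction on the number of edges: after removing an edge [e] its ends lie in different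
    components, so a potential on the rest can be shifted by a constant on one of them to give [e]
    the right difference. *)
Lemma forest_potential Theta M (y : edge Xi -> M) :
    (forall s, circuit s -> ~~ all (fun o : oedge Xi => val o.1 \in Theta) s) ->
  exists x : vertex Xi -> M,
    forall e : edge Xi, val e \in Theta -> x (d1 (val e)) - x (d0 (val e)) = y e.
Proof.
have [k] := ubnP #|[set e : edge Xi | val e \in Theta]|%SET.
elim: k Theta => // k IH Theta; rewrite ltnS => leT acyc.
have [e /= eT|noe] := pickP (fun e : edge Xi => val e \in Theta); last first.
  by exists (fun=> 0) => e; rewrite noe.
pose S := (Theta :\ val e)%SET.
have ST o : o \in S -> o \in Theta by rewrite inE => /andP[].
have [||x xS] := IH S.
- apply: leq_trans leT; apply: proper_card; apply/properP; split.
    by apply/fintype.subsetP => o; rewrite !inE => /andP[].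
  by exists e; rewrite !inE ?eT ?eqxx.
- move=> s /acyc; apply: contra; apply: sub_all => o; exact: ST.
pose comp := connect (adjacent S) (d1 (val e)).
(* The component of [d1 e] is shifted by the error of [x] at [e]; every other edge has both ends
   shifted or neither. *)
exists (fun w => x w + if comp w then y e - (x (d1 (val e)) - x (d0 (val e))) else 0).
move=> e' e'T; have [->|ne] := eqVneq e' e.
  rewrite /comp connect0 (negPf (forest_separates acyc eT)) addr0.
  by rewrite addrCA subKr addrK.
have e'S : val e' \in S by rewrite !inE e'T andbT (inj_eq val_inj).
have -> : comp (d1 (val e')) = comp (d0 (val e')).
  rewrite /comp !(sym_connect_sym (@adjacent_sym S) (d1 (val e))).
  apply/esym/same_connect; first exact/sym_connect_sym/adjacent_sym.
  exact/connect1/adjacent_edge.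
by rewrite [X in _ - X]addrC addrKA xS.
Qed.

Lemma connected_on_constant S (T : Type) (x : vertex Xi -> T) :
    connected_on S ->
    (forall e : edge Xi, val e \in S -> x (d1 (val e)) = x (d0 (val e))) ->
  forall u v, x u = x v.
Proof.
move=> [_ cS] xS u v; have /connectP[p + ->] := cS u v.
elim: p u => //= w p IH u /andP[/adjacentP[[e b] [eS <- <-]] /IH <-].
by rewrite /origin /target; move: b eS => [] /= /xS.
Qed.

End Potentials.

(** * The universal property of the fundamental group *)

Section Morphisms.
Variables (A B : groupType) (f : A -> B).
Hypothesis fM : {morph f : x y / (x * y)%g}.

Lemma morphism1 : f 1%g = 1%g.
Proof. by apply: (mulgI (f 1%g)); rewrite -fM !mulg1. Qed.

Lemma morphismV x : f x^-1%g = (f x)^-1%g.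
Proof. by apply: (mulgI (f x)); rewrite -fM !mulgV morphism1. Qed.

Lemma morphism_kernel_normal : normal_subgroup [set x | f x = 1%g].
Proof.
split; first split => /=; first exact: morphism1.
- by move=> x y; rewrite fM => -> ->; rewrite mulg1.
- by move=> x; rewrite morphismV => ->; rewrite invg1.
- by move=> x g /=; rewrite /conjg !fM morphismV => ->; rewrite mul1g mulVg.
Qed.

Lemma morphism_range_subgroup : subgroup (range f).
Proof.
split; first by exists 1%g => //; exact: morphism1.
- by move=> _ _ [x _ <-] [y _ <-]; exists (x * y)%g.
- by move=> _ [x _ <-]; exists x^-1%g => //; exact: morphismV.
Qed.

End Morphisms.

(** The factor is [Psi] composed with any section of [p]. It is continuous because [p], from a
    compact to a Hausdorff space, is a closed map: the preimage of a closed [A] is the image under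
    [p] of its preimage under [Psi]. *)
Lemma continuous_hom_factor (W G K : profiniteGroupType) (p : W -> G)
    (Psi : W -> K) :
    continuous_hom p -> set_surj [set: W] [set: G] p -> continuous_hom Psi ->
    [set w | p w = 1%g] `<=` [set w | Psi w = 1%g] ->
  exists2 psi : G -> K, continuous_hom psi & forall w, psi (p w) = Psi w.
Proof.
move=> [pM cp] psurj [PM cP] ker.
have /choice[s sK] : forall g, exists w, p w = g.
  by move=> g; have [w _ <-] := psurj g I; exists w.
have sp w : Psi (s (p w)) = Psi w.
  apply: (mulgI (Psi w)^-1%g); rewrite mulVg -(morphismV PM) -PM; apply: ker => /=.
  by rewrite pM (morphismV pM) sK mulVg.
exists (Psi \o s) => //; split.
  by move=> x y /=; rewrite -PM -[RHS]sp pM !sK.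
apply/continuous_closedP => A cA.
have -> : (Psi \o s) @^-1` A = p @` (Psi @^-1` A).
  apply/seteqP; split=> [g /= Ag|_ [w /= Aw <-] /=]; last by rewrite sp.
  by exists (s g).
apply: compact_closed; first exact: profinite_hausdorff.
apply: continuous_compact; first exact: continuous_subspaceT.
apply: subclosed_compact (@profinite_compact W) _ => //.
by move/continuous_closedP: cP; apply.
Qed.

(* s e is the image of the stable letter t_e in G. *)
Definition fundamental_universal (Xi : finGraph)
    (GG : graphOfProfiniteGroups Xi) (Theta : {set Xi})
    (G : profiniteGroupType) (nu : forall v : vertex Xi, GG (val v) -> G)
    (s : edge Xi -> G) : Prop :=
  [/\ forall v, continuous_hom (nu v),
      forall e, val e \in Theta -> s e = 1%g,
      forall e (g : GG (val e)),
        (nu (d0 (val e)) (bd0 g) * s e = s e * nu (d1 (val e)) (bd1 g))%g,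
      forall (K : profiniteGroupType) (phi : forall v : vertex Xi, GG (val v) -> K)
          (tau : edge Xi -> K),
        (forall v, continuous_hom (phi v)) ->
        (forall e, val e \in Theta -> tau e = 1%g) ->
        (forall e (g : GG (val e)), (phi (d0 (val e)) (bd0 g) * tau e
           = tau e * phi (d1 (val e)) (bd1 g))%g) ->
        exists psi : G -> K, [/\ continuous_hom psi,
          forall v g, psi (nu v g) = phi v g & forall e, psi (s e) = tau e]
    & forall (K : profiniteGroupType) (psi psi' : G -> K),
        continuous_hom psi -> continuous_hom psi' ->
        (forall v g, psi (nu v g) = psi' (nu v g)) ->
        (forall e, psi (s e) = psi' (s e)) ->
        psi = psi'].

Lemma relator_eq1 (A : groupType) (a b c : A) :
  (a^-1 * c^-1 * b * c)%g = 1%g -> (b * c = c * a)%g.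
Proof.
by move=> h; apply: (mulgI (a^-1 * c^-1)%g); rewrite !mulgA h mulgVK mulVg.
Qed.

Lemma comp_continuous_hom (A B C : profiniteGroupType) (f : A -> B) (g : B -> C) :
  continuous_hom f -> continuous_hom g -> continuous_hom (g \o f).
Proof.
move=> [fM cf] [gM cg]; split; first by move=> x y /=; rewrite fM gM.
by move=> x; apply: continuous_comp; [exact: cf|exact: cg].
Qed.

(** Existence: freeness of [F] and then of [W] gives a map on [W], which factors through [p].
    Uniqueness: as [p] is onto, it can be tested on [W], and there on each free factor. *)
Lemma fundamental_groupP (Xi : finGraph) (GG : graphOfProfiniteGroups Xi)
    (Theta : {set Xi}) (G : profiniteGroupType)
    (nu : forall v : vertex Xi, GG (val v) -> G) :
  is_fundamental_group Theta nu ->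
  exists s : edge Xi -> G, fundamental_universal Theta nu s.
Proof.
move=> [F [t [W [iota [p [Ffree [iotah Wfree] [ph psurj pker] nuE]]]]]].
have pM := ph.1.
have relE w : relators Theta t iota w -> p w = 1%g.
  move=> Rw; suff : [set w | p w = 1%g] w by [].
  by rewrite pker => N [_ _]; apply.
exists (p \o stable t iota); split.
- move=> v; have -> : nu v = p \o @iota (Some v) by apply/funext => g; exact: nuE.
  exact: (comp_continuous_hom (iotah (Some v)) ph).
- by move=> e eT /=; apply: relE; left; exists e.
- move=> e g; rewrite !nuE /=.
  have : p (edge_relator t iota g) = 1%g by apply: relE; right; exists e => //; exists g.
  by rewrite /edge_relator !pM !(morphismV pM); exact: relator_eq1.
- move=> K phi tau phih tauT phitau.
  have [psiF [[psiFh psiFt] _]] := Ffree K tau.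
  pose Phi (i : option (vertex Xi)) : free_factor GG F i -> K :=
    if i is Some v then phi v else psiF.
  have Phih i : continuous_hom (Phi i) by case: i => [v|]; [exact: phih|].
  have [Psi [[Psih PsiE] _]] := Wfree K Phi Phih.
  have PM := Psih.1.
  have PsiS e : Psi (stable t iota e) = tau e.
    by rewrite /stable (PsiE None) /Phi psiFt.
  have [|psi psih psiE] := continuous_hom_factor ph psurj Psih.
    (* The kernel of [Psi] is a closed normal subgroup containing the relators, so it contains their
       closed normal closure. *)
    rewrite pker => w; apply; split; first exact: morphism_kernel_normal.
      have /continuous_closedP cP := Psih.2.
      apply: (cP [set 1%g]); apply: compact_closed; first exact: profinite_hausdorff.
      exact: compact_set1.
    move=> _ [[e eT <-]|[e _ [g _ <-]]] /=; first by rewrite PsiS tauT.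
    rewrite /edge_relator !PM !(morphismV PM) !PsiS (PsiE (Some _)) (PsiE (Some _)) /Phi.
    by rewrite -!mulgA phitau !mulgA mulgVK mulVg.
  exists psi; split=> // [v g|e]; first by rewrite nuE psiE (PsiE (Some v)).
  by rewrite /= psiE.
- move=> K psi psi' psih psi'h psinu psis.
  suff E : psi \o p = psi' \o p.
    by apply/funext => g; have [w _ <-] := psurj g I; exact: (congr1 (fun f => f w) E).
  pose Phi i := psi \o p \o @iota i.
  have cW (q : G -> K) : continuous_hom q -> continuous_hom (q \o p).
    exact: comp_continuous_hom.
  have [|Psi [_ uPsi]] := Wfree K Phi.
    by move=> i; apply: comp_continuous_hom => //; exact: cW.
  rewrite -(uPsi (psi \o p)); last by split; [exact: cW|].
  apply: uPsi; split; first exact: cW.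
  move=> [v|] a /=; first by rewrite /Phi /= -!nuE psinu.
  (* On the factor [F], homomorphisms which agree on the stable letters coincide. *)
  have [psiF [_ uF]] := Ffree K (fun e => psi (p (stable t iota e))).
  suff : psi' \o p \o @iota None = psi \o p \o @iota None by move/(congr1 (fun f => f a)).
  rewrite -(uF (psi \o p \o @iota None)); last first.
    by split=> //; exact: (comp_continuous_hom (iotah None) (cW _ psih)).
  apply/esym/uF; split; last by move=> e; rewrite psis.
  exact: (comp_continuous_hom (iotah None) (cW _ psi'h)).
Qed.

(** * Derivations in modules over finite quotients *)

(** Continuity for the discrete topology on [A], in a form which puts no topology on [A]. *)
Definition locally_constant (T : topologicalType) (A : Type) (f : T -> A) : Prop :=
  forall x, \forall y \near x, f y = f x.

Section LocallyConstant.
Variable T : topologicalType.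

Lemma locally_constant_continuous (A : choiceType) (f : T -> A) :
  continuous (f : T -> discrete_topology A) <-> locally_constant f.
Proof.
split=> cf x; first by have /discrete_cvg := cf x.
by apply/discrete_cvg; exact: cf.
Qed.

Lemma locally_constant_comp (A B : Type) (f : T -> A) (h : A -> B) :
  locally_constant f -> locally_constant (h \o f).
Proof. by move=> cf x; apply: filterS (cf x) => y /= ->. Qed.

Lemma locally_constant_pair (A B : Type) (f : T -> A) (g : T -> B) :
  locally_constant f -> locally_constant g ->
  locally_constant (fun x => (f x, g x)).
Proof. by move=> cf cg x; apply: filterS2 (cf x) (cg x) => y -> ->. Qed.

End LocallyConstant.

(** * Finite groups as discrete profinite groups *)

Definition discrete_group (B : finGroupType) : Type := discrete_topology B.

Section DiscreteGroup.
Variable B : finGroupType.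

HB.instance Definition _ := Group.copy (discrete_group B) B.
HB.instance Definition _ := Topological.copy (discrete_group B) (discrete_topology B).

Let continuous_discrete (T : discreteTopologicalType) (T' : topologicalType)
  (f : T -> T') : continuous f.
Proof.
move=> x A /nbhs_singleton Afx; change (nbhs x (f @^-1` A)).
by apply: filterS (discrete_set1 x) => y ->.
Qed.

Lemma discrete_mulg_continuous :
  continuous (fun xy : discrete_group B * discrete_group B => (xy.1 * xy.2)%g).
Proof.
move=> [x y] A /nbhs_singleton /= Axy.
exists ([set x], [set y]); first by split; exact: discrete_set1.
by move=> [x' y'] [/= -> ->].
Qed.

Lemma discrete_invg_continuous :
  continuous (fun x : discrete_group B => x^-1%g).
Proof. exact: continuous_discrete. Qed.

HB.instance Definition _ := isTopologicalGroup.Build (discrete_group B)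
  discrete_mulg_continuous discrete_invg_continuous.

Lemma discrete_group_compact : compact [set: discrete_group B].
Proof. by apply: finite_compact; exact: (@finite_finset B). Qed.

HB.instance Definition _ := isProfinite.Build (discrete_group B)
  discrete_group_compact (@discrete_hausdorff (discrete_topology B))
  (zero_dimension_totally_disconnected
     (@discrete_zero_dimension (discrete_topology B))).
End DiscreteGroup.

(** * Finite right modules and their semidirect products *)

Record gmodule (Q : finGroupType) := GModule {
  gmodule_sort :> finZmodType;
  gact : gmodule_sort -> Q -> gmodule_sort;
  gactD : forall q, {morph gact^~ q : x y / x + y};
  gact1 : forall x, gact x 1%g = x;
  gactM : forall x q r, gact x (q * r)%g = gact (gact x q) r
}.

Section Semidirect.
Variables (Q : finGroupType) (M : gmodule Q).

Lemma gact0 (q : Q) : gact (0 : M) q = 0.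
Proof. by apply: (addrI (gact 0 q)); rewrite -gactD !addr0. Qed.

Lemma gactN (q : Q) : {morph (fun x : M => gact x q) : x / - x}.
Proof. by move=> x; apply: (addrI (gact x q)); rewrite -gactD !subrr gact0. Qed.

Lemma gactB (q : Q) : {morph (fun x : M => gact x q) : x y / x - y}.
Proof. by move=> x y; rewrite gactD gactN. Qed.

(** The product below makes [g |-> (f g, q g)] multiplicative, for a homomorphism [q], exactly when
    [f] is a derivation along [q]. The universal property for homomorphisms thus becomes one for
    derivations. *)
Definition semidirect : Type := (M * Q)%type.
HB.instance Definition _ := Finite.on semidirect.

Definition semidirect_one : semidirect := (0, 1%g).
Definition semidirect_mul (a b : semidirect) : semidirect :=
  (gact a.1 b.2 + b.1, a.2 * b.2)%g.
Definition semidirect_inv (a : semidirect) : semidirect :=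
  (- gact a.1 a.2^-1%g, a.2^-1)%g.

Lemma semidirect_mulA : associative semidirect_mul.
Proof.
by move=> [a q] [b r] [c s]; rewrite /semidirect_mul /= gactM gactD mulgA addrA.
Qed.
Lemma semidirect_mul1 : left_id semidirect_one semidirect_mul.
Proof. by move=> [a q]; rewrite /semidirect_mul /= gact0 add0r mul1g. Qed.
Lemma semidirect_1mul : right_id semidirect_one semidirect_mul.
Proof. by move=> [a q]; rewrite /semidirect_mul /= gact1 addr0 mulg1. Qed.
Lemma semidirect_mulV : left_inverse semidirect_one semidirect_inv semidirect_mul.
Proof.
move=> [a q]; rewrite /semidirect_mul /= gactN -gactM !mulVg gact1.
by rewrite addNr.
Qed.
Lemma semidirect_Vmul : right_inverse semidirect_one semidirect_inv semidirect_mul.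
Proof. by move=> [a q]; rewrite /semidirect_mul /= subrr mulgV. Qed.

HB.instance Definition _ := isGroup.Build semidirect
  semidirect_mulA semidirect_mul1 semidirect_1mul semidirect_mulV semidirect_Vmul.

End Semidirect.

Section QuotPi.
Variables (G : profiniteGroupType) (U : openNormal G).

Lemma quot_pi_locally_constant : locally_constant (quot_pi U).
Proof.
have [[U1 _ _] _] := open_normal_normal U.
move=> x; have c : continuous (fun y : G => (x^-1 * y)%g).
  by apply: mul_continuous2 => y; [exact: cvg_cst|exact: cvg_id].
have : nbhs x ((fun y : G => (x^-1 * y)%g) @^-1` open_normal_set U).
  apply: c; apply: open_nbhs_nbhs; split; first exact: open_normal_open.
  by rewrite mulVg.
by apply: filterS => y /= Uy; apply/esym/quot_eqP.
Qed.

Lemma quot_pi_hom : @continuous_hom G (discrete_group (quot U)) (quot_pi U).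
Proof.
split; first exact: quot_piM.
by apply/(@locally_constant_continuous G (quot U)); exact: quot_pi_locally_constant.
Qed.

Variable M : gmodule (quot U).

Definition quot_derivation (f : G -> M) : Prop :=
  (forall g h, f (g * h)%g = gact (f g) (quot_pi U h) + f h) /\ locally_constant f.

Lemma quot_derivation_hom (f : G -> M) : quot_derivation f ->
  @continuous_hom G (discrete_group (semidirect M)) (fun g => (f g, quot_pi U g)).
Proof.
move=> [fM cf]; split.
  by move=> x y; rewrite fM quot_piM.
apply/(@locally_constant_continuous G (semidirect M)).
by apply: locally_constant_pair => //; exact: quot_pi_locally_constant.
Qed.

Lemma quot_derivationD (f f' : G -> M) :
  quot_derivation f -> quot_derivation f' -> quot_derivation (f \+ f').
Proof.
move=> [fM cf] [f'M cf']; split.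
  by move=> g h /=; rewrite fM f'M gactD addrACA.
exact: (locally_constant_comp (fun z : M * M => z.1 + z.2)
  (locally_constant_pair cf cf')).
Qed.

Lemma quot_derivation0 : quot_derivation (fun=> 0).
Proof.
split; first by move=> g h; rewrite gact0 addr0.
by move=> x; exact: nearW.
Qed.

Lemma quot_derivation_sum (I : finType) (f : I -> G -> M) :
  (forall i, quot_derivation (f i)) -> quot_derivation (fun g => \sum_i f i g).
Proof.
move=> fd; elim: (index_enum I) => [|i s IH].
  by under eq_fun do rewrite big_nil; exact: quot_derivation0.
by under eq_fun do rewrite big_cons; exact: quot_derivationD.
Qed.

Lemma quot_derivation_inner (x : M) :
  quot_derivation (fun g => gact x (quot_pi U g) - x).
Proof.
split; first by move=> g h; rewrite gactB -gactM -quot_piM addrA subrK.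
exact: (locally_constant_comp (fun q => gact x q - x) quot_pi_locally_constant).
Qed.

End QuotPi.

Lemma quot_derivation_morph (G : profiniteGroupType) (U V : openNormal G)
    (M : gmodule (quot U)) (N : gmodule (quot V)) (phi : M -> N) (f : G -> M) :
    {morph phi : x y / x + y} ->
    (forall x g, phi (gact x (quot_pi U g)) = gact (phi x) (quot_pi V g)) ->
  quot_derivation f -> quot_derivation (phi \o f).
Proof.
move=> phiD phiG [fM cf]; split; first by move=> g h /=; rewrite fM phiD phiG.
exact: locally_constant_comp.
Qed.

Section Generators.
Variables (Xi : finGraph) (GG : graphOfProfiniteGroups Xi) (Theta : {set Xi})
  (G : profiniteGroupType) (nu : forall v : vertex Xi, GG (val v) -> G)
  (s : edge Xi -> G).
Arguments nu : clear implicits.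
Hypothesis Guniv : fundamental_universal Theta nu s.
Variables (U : openNormal G) (M : gmodule (quot U)).

Lemma quot_derivation_unique (f f' : G -> M) :
    quot_derivation f -> quot_derivation f' ->
    (forall v g, f (nu v g) = f' (nu v g)) -> (forall e, f (s e) = f' (s e)) ->
  f = f'.
Proof.
have [_ _ _ _ uniq] := Guniv.
move=> /quot_derivation_hom fh /quot_derivation_hom f'h fnu fs.
suff E : (fun g => (f g, quot_pi U g)) = (fun g => (f' g, quot_pi U g)).
  by apply/funext => g; exact: (congr1 (fun k => (k g).1) E).
by apply: (uniq _ _ _ fh f'h) => [v g|e]; rewrite ?fnu ?fs.
Qed.

(** The prescribed values define a homomorphism to the semidirect product, and [f] is its first
    component. The condition on [Theta] makes tree letters trivial; invariance of [y e] gives the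
    edge relation. *)
Lemma quot_derivation_exists (x : vertex Xi -> M) (y : edge Xi -> M) :
    (forall e, val e \in Theta -> x (d1 (val e)) - x (d0 (val e)) = y e) ->
    (forall e g, gact (y e) (quot_pi U (nu (d1 (val e)) (bd1 g))) = y e) ->
  exists f : G -> M, [/\ quot_derivation f,
    forall v g, f (nu v g) = gact (x v) (quot_pi U (nu v g)) - x v
    & forall e, f (s e) = gact (x (d0 (val e))) (quot_pi U (s e)) - x (d1 (val e)) + y e].
Proof.
move=> xy yinv; have [nuh sT nus ex uniq] := Guniv.
have pi1 : quot_pi U 1%g = 1%g by [].
pose K := discrete_group (semidirect M).
pose phi v (g : GG (val v)) : K :=
  (gact (x v) (quot_pi U (nu v g)) - x v, quot_pi U (nu v g)).
pose tau e : K :=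
  (gact (x (d0 (val e))) (quot_pi U (s e)) - x (d1 (val e)) + y e, quot_pi U (s e)).
have [|||psi [[psiM psic] psinu psis]] := ex K phi tau.
- move=> v; exact: (comp_continuous_hom (nuh v)
    (quot_derivation_hom (quot_derivation_inner (x v)))).
- move=> e eT; rewrite /tau sT // pi1 gact1.
  by rewrite -(xy e eT) -opprB addNr.
- move=> e g; rewrite /phi /tau.
  rewrite [LHS]/(semidirect_mul _ _) [RHS]/(semidirect_mul _ _) /semidirect_mul /=.
  rewrite -!quot_piM -nus; congr (_, _).
  rewrite !(gactD, gactN) -!gactM -!quot_piM -nus yinv.
  rewrite !addrA subrK -!addrA; congr (_ + _).
  by rewrite [RHS]addrCA addKr addrC.
(* The second component is a homomorphism which agrees with [quot_pi] on the generators. *)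
have snd_pi g : (psi g).2 = quot_pi U g.
  have sndh : @continuous_hom K (discrete_group (quot U)) snd.
    split=> //; apply/(@locally_constant_continuous K (quot U)) => z.
    by apply: (filterS _ (discrete_set1 (z : discrete_topology (semidirect M)))) => w ->.
  have := uniq _ _ _ (comp_continuous_hom (conj psiM psic) sndh) (quot_pi_hom U).
  move=> E; apply: (congr1 (fun k => k g)) (E _ _) => [v h|e] /=.
    by rewrite psinu.
  by rewrite psis.
exists (fst \o psi); split.
- split; first by move=> g h /=; rewrite psiM /= snd_pi.
  apply: (locally_constant_comp fst).
  exact/(@locally_constant_continuous G (semidirect M)).
- by move=> v g /=; rewrite psinu.
- by move=> e /=; rewrite psis.
Qed.

End Generators.

(** * Permutation modules *)

Section AdditiveMorphism.
Variables (M N : zmodType) (phi : M -> N).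
Hypothesis phiD : {morph phi : x y / x + y}.

Lemma additive_morph0 : phi 0 = 0.
Proof. by apply: (addrI (phi 0)); rewrite -phiD !addr0. Qed.

Lemma additive_morphN : {morph phi : x / - x}.
Proof. by move=> x; apply: (addrI (phi x)); rewrite -phiD !subrr additive_morph0. Qed.

Lemma additive_morphMn n : {morph phi : x / x *+ n}.
Proof. by move=> x; elim: n => [|n IH]; rewrite ?additive_morph0 // !mulrS phiD IH. Qed.

Lemma additive_morphMz n : {morph phi : x / x *~ n}.
Proof.
move=> x; case: n => n; first by rewrite -!pmulrn additive_morphMn.
by rewrite !NegzE !mulrNz additive_morphN -!pmulrn additive_morphMn.
Qed.

Lemma additive_morph_sum (I : Type) (r : seq I) (F : I -> M) :
  phi (\sum_(i <- r) F i) = \sum_(i <- r) phi (F i).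
Proof. exact: (big_morph phi phiD additive_morph0). Qed.

End AdditiveMorphism.

Lemma sum_mulrn_eq (I : finType) (M : zmodType) (F : I -> M) (i : I) :
  \sum_j F j *+ (i == j) = F i.
Proof.
rewrite (bigD1 i) //= eqxx mulr1n big1 ?addr0 // => j ji.
by rewrite eq_sym (negPf ji).
Qed.

Record gset (Q : finGroupType) := GSet {
  gset_sort :> finType;
  gset_act : gset_sort -> Q -> gset_sort;
  gset_act1 : forall x, gset_act x 1%g = x;
  gset_actM : forall x q r, gset_act x (q * r)%g = gset_act (gset_act x q) r
}.

Section GSets.
Variable Q : finGroupType.

Definition translation_gset : gset Q :=
  @GSet Q _ (fun x q => (x * q)%g) (@mulg1 Q) (@mulgA Q).

Lemma set_gset1 (S : {set Q}) : (S :* 1)%g = S.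
Proof. exact: mulg1. Qed.

(** All coset spaces of subgroups of [Q] are orbits in this one set, so a single module [R[X]] holds
    the images of all edge and vertex groups. *)
Definition set_gset : gset Q :=
  @GSet Q _ (fun S q => (S :* q)%g) set_gset1 (@rcosetM Q).

Variable X : gset Q.

Lemma gset_actK (q : Q) : cancel (fun x : X => gset_act x q) (fun x => gset_act x q^-1%g).
Proof. by move=> x; rewrite -gset_actM mulgV gset_act1. Qed.

Lemma gset_actVK (q : Q) : cancel (fun x : X => gset_act x q^-1%g) (fun x => gset_act x q).
Proof. by move=> x; rewrite -gset_actM mulVg gset_act1. Qed.
End GSets.

Definition fun_module (R : finPzRingType) (X : finType) : Type := {ffun X -> R}.
HB.instance Definition _ (R : finPzRingType) (X : finType) :=
  Finite.on (fun_module R X).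
HB.instance Definition _ (R : finPzRingType) (X : finType) :=
  GRing.Zmodule.on (fun_module R X).

Section FunctionModule.
Variables (R : finPzRingType) (Q : finGroupType) (X : gset Q).

Definition fun_act (a : fun_module R X) (q : Q) : fun_module R X :=
  [ffun x => a (gset_act x q^-1%g)].

Lemma fun_actD q : {morph (fun a => fun_act a q) : a b / a + b}.
Proof. by move=> a b; apply/ffunP => x; rewrite !ffunE. Qed.
Lemma fun_act1 a : fun_act a 1%g = a.
Proof. by apply/ffunP => x; rewrite ffunE invg1 gset_act1. Qed.
Lemma fun_actM a q r : fun_act a (q * r)%g = fun_act (fun_act a q) r.
Proof. by apply/ffunP => x; rewrite !ffunE invgM gset_actM. Qed.

(** The permutation module [R[X]]. For [translation_gset] it is convertible to [group_algebra] with
    the action [galg_mulr]. *)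
Definition fun_gmodule : gmodule Q :=
  GModule fun_actD fun_act1 fun_actM.

Definition delta (x : X) : fun_gmodule := [ffun z => (z == x)%:R].

Lemma delta_act x q : gact (delta x) q = delta (gset_act x q).
Proof.
apply/ffunP => z; rewrite !ffunE; congr (_ _).
by congr nat_of_bool; apply/eqP/eqP => [<-|->]; rewrite ?gset_actVK ?gset_actK.
Qed.

Lemma delta_inj : (1 : R) != 0 -> injective delta.
Proof.
move=> R1 x y /ffunP/(_ x); rewrite !ffunE eqxx.
by have [//|_] := eqVneq x y; move/eqP; rewrite (negPf R1).
Qed.
End FunctionModule.

Section Push.
Variables (R : finPzRingType) (Q Q' : finGroupType).
Variables (X : gset Q) (Y : gset Q') (h : X -> Y).

(** The linear extension of [h]. The two groups may differ, which covers the projections from [G/U]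
    to [G/V]. *)
Definition push (a : fun_gmodule R X) : fun_gmodule R Y :=
  [ffun y => \sum_(x | h x == y) a x].

Lemma pushD : {morph push : a b / a + b}.
Proof.
move=> a b; apply/ffunP => y; rewrite !ffunE -big_split /=.
by apply: eq_bigr => x _; rewrite ffunE.
Qed.

Lemma push_delta x : push (delta R x) = delta R (h x).
Proof.
apply/ffunP => y; rewrite !ffunE big_mkcond (bigD1 x) //= big1 => [|z zx].
  by rewrite ffunE eqxx addr0 eq_sym; case: eqP.
by rewrite ffunE (negPf zx) if_same.
Qed.
End Push.

Section Equivariance.
Variables (R : finPzRingType) (Q : finGroupType) (X Y : gset Q) (h : X -> Y).
Hypothesis hQ : forall x q, h (gset_act x q) = gset_act (h x) q.

Lemma push_act a q : push (R := R) h (gact a q) = gact (push h a) q.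
Proof.
apply/ffunP => y; rewrite !ffunE (reindex_inj (can_inj (@gset_actK Q X q))).
apply: eq_big => [x|x _]; last by rewrite ffunE gset_actK.
by rewrite hQ; apply/eqP/eqP => [<-|->]; rewrite ?gset_actVK ?gset_actK.
Qed.

(** When [h] maps [q] to the coset [E q], this sends a coset to the sum of its elements and so
    embeds [R[E\Q]] in [R[Q]]. *)
Definition pull (b : fun_gmodule R Y) : fun_gmodule R X := [ffun x => b (h x)].

Lemma pullD : {morph pull : a b / a + b}.
Proof. by move=> a b; apply/ffunP => y; rewrite !ffunE. Qed.

Lemma pull_act a q : pull (gact a q) = gact (pull a) q.
Proof. by apply/ffunP => y; rewrite !ffunE hQ. Qed.
End Equivariance.

Section Restriction.
Variables (R : finPzRingType) (Q : finGroupType) (X : gset Q) (P : pred X).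
Hypothesis PQ : forall x q, P (gset_act x q) = P x.

Definition restriction (a : fun_gmodule R X) : fun_gmodule R X :=
  [ffun x => if P x then a x else 0].

Lemma restrictionD : {morph restriction : a b / a + b}.
Proof. by move=> a b; apply/ffunP => y; rewrite !ffunE; case: ifP; rewrite ?addr0. Qed.

Lemma restriction_act a q : restriction (gact a q) = gact (restriction a) q.
Proof. by apply/ffunP => y; rewrite !ffunE PQ. Qed.

Lemma restriction_delta x : P x -> restriction (delta R x) = delta R x.
Proof.
move=> Px; apply/ffunP => y; rewrite !ffunE.
by case: eqP => [->|]; rewrite ?Px ?if_same.
Qed.
End Restriction.

Section ImageGroup.
Variables (A G : profiniteGroupType) (h : A -> G) (U : openNormal G).
Hypothesis hM : {morph h : x y / (x * y)%g}.

Definition quot_image : {set quot U} :=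
  [set q | `[< exists a, quot_pi U (h a) = q >]]%SET.

Lemma mem_quot_image a : quot_pi U (h a) \in quot_image.
Proof. by rewrite inE; apply/asboolP; exists a. Qed.

Lemma quot_imageP q : reflect (exists a, quot_pi U (h a) = q) (q \in quot_image).
Proof. by rewrite inE; exact: asboolP. Qed.

Lemma quot_image_group_set : group_set quot_image.
Proof.
apply/group_setP; split.
  by apply/quot_imageP; exists 1%g; rewrite (morphism1 hM).
move=> _ _ /quot_imageP[a <-] /quot_imageP[b <-].
by rewrite -quot_piM -hM mem_quot_image.
Qed.

Definition quot_image_group : {group quot U} := fingroup.group quot_image_group_set.

End ImageGroup.

(** * Derivations attached to edges *)

Section EdgeDerivations.
Variables (Xi : finGraph) (GG : graphOfProfiniteGroups Xi) (Theta : {set Xi})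
  (G : profiniteGroupType) (nu : forall v : vertex Xi, GG (val v) -> G)
  (s : edge Xi -> G).
Arguments nu : clear implicits.
Hypothesis Guniv : fundamental_universal Theta nu s.
Variable c : edge Xi -> vertex Xi -> int.
Hypothesis c_tree : forall e0 e : edge Xi, val e \in Theta ->
  c e0 (d1 (val e)) - c e0 (d0 (val e)) = (e == e0)%:R.

Definition edge_image (e : edge Xi) (g : GG (val e)) : G := nu (d1 (val e)) (bd1 g).

(** The coordinate [e0] of the derivation: [y_e] is [y] at [e0] and 0 elsewhere, with potential
    [x_v] equal to [c e0 v] times [y]. Integer coefficients let one [c] serve all modules and
    commute with additive maps. *)
Definition edge_derivation (e0 : edge Xi) (U : openNormal G) (M : gmodule (quot U))
    (y : M) (f : G -> M) : Prop :=
  [/\ quot_derivation f,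
      forall v g, f (nu v g) = gact (y *~ c e0 v) (quot_pi U (nu v g)) - y *~ c e0 v
    & forall e, f (s e) = gact (y *~ c e0 (d0 (val e))) (quot_pi U (s e))
        - y *~ c e0 (d1 (val e)) + y *+ (e == e0)].

Lemma edge_imageM e : {morph @edge_image e : x y / (x * y)%g}.
Proof.
have [nuh _ _ _ _] := Guniv; move=> x y.
by rewrite /edge_image (bd1_hom GG e).1 (nuh _).1.
Qed.

Lemma edge_derivation_exists e0 (U : openNormal G) (M : gmodule (quot U)) (y : M) :
    (forall g, gact y (quot_pi U (@edge_image e0 g)) = y) ->
  exists f, edge_derivation e0 y f.
Proof.
move=> yinv; apply: (quot_derivation_exists Guniv (x := fun v => y *~ c e0 v)
  (y := fun e => y *+ (e == e0))).
  by move=> e eT; rewrite -mulrzBr c_tree // mulrz_nat.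
move=> e g; have [ee|_] := eqVneq e e0; last by rewrite gact0.
by case: _ / ee in y yinv *; rewrite mulr1n yinv.
Qed.

Lemma edge_derivation_unique e0 (U : openNormal G) (M : gmodule (quot U)) (y : M) f f' :
  edge_derivation e0 y f -> edge_derivation e0 y f' -> f = f'.
Proof.
move=> [fd fnu fs] [f'd f'nu f's]; apply: (quot_derivation_unique Guniv) => //.
  by move=> v g; rewrite fnu f'nu.
by move=> e; rewrite fs f's.
Qed.

(** Together with uniqueness, this identifies derivations in different modules by comparing only the
    elements [y]. *)
Lemma edge_derivation_morph e0 (U V : openNormal G) (M : gmodule (quot U))
    (N : gmodule (quot V)) (phi : M -> N) (y : M) f :
    {morph phi : x y / x + y} ->
    (forall x g, phi (gact x (quot_pi U g)) = gact (phi x) (quot_pi V g)) ->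
  edge_derivation e0 y f -> edge_derivation e0 (phi y) (phi \o f).
Proof.
move=> phiD phiG [fd fnu fs]; split; first exact: quot_derivation_morph.
- move=> v g /=; rewrite fnu phiD phiG (additive_morphN phiD).
  by rewrite !(additive_morphMz phiD).
- move=> e /=; rewrite fs !phiD phiG (additive_morphN phiD).
  by rewrite !(additive_morphMz phiD) (additive_morphMn phiD).
Qed.

End EdgeDerivations.

(** * Boundary maps of coset modules and separation from the vertex group *)

Section Separation.
Variables (Xi : finGraph) (GG : graphOfProfiniteGroups Xi) (Theta : {set Xi})
  (G : profiniteGroupType) (nu : forall v : vertex Xi, GG (val v) -> G)
  (s : edge Xi -> G).
Arguments nu : clear implicits.
Hypothesis Guniv : fundamental_universal Theta nu s.
Hypothesis Theta_connected : connected_on Theta.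
Variable c : edge Xi -> vertex Xi -> int.
Hypothesis c_tree : forall e0 e : edge Xi, val e \in Theta ->
  c e0 (d1 (val e)) - c e0 (d0 (val e)) = (e == e0)%:R.
Variable v0 : vertex Xi.
Hypothesis c_v0 : forall e0, c e0 v0 = 0.
Variables (R : finPzRingType) (U : openNormal G).

Local Notation RS := (fun_gmodule R (set_gset (quot U))).
Local Notation nuM v := (let: And5 h _ _ _ _ := Guniv in (h v).1).
Local Notation K v := (quot_image (nu v) U).
Local Notation E e := (quot_image (@edge_image Xi GG G nu e) U).
Local Notation dl S := (delta R (S : set_gset (quot U))).

Lemma quot_image_absorb v g : (K v :* quot_pi U (nu v g))%g = K v.
Proof.
by apply: (@rcoset_id _ (quot_image_group U (nuM v))); exact: mem_quot_image.
Qed.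

Lemma edge_absorb1 e : (K (d1 (val e)) * E e)%g = K (d1 (val e)).
Proof.
have eM := edge_imageM Guniv (e := e).
apply: (@mulGSid _ (quot_image_group U (nuM _)) (quot_image_group U eM)).
by apply/fintype.subsetP => _ /quot_imageP[g <-]; exact: mem_quot_image.
Qed.

(** By the edge relation, the conjugate of [E e] by the stable letter lies in the group of the
    initial vertex. *)
Lemma edge_absorb0 e : (K (d0 (val e)) :* quot_pi U (s e) * E e)%g
  = (K (d0 (val e)) :* quot_pi U (s e))%g.
Proof.
have [_ _ nus _ _] := Guniv.
apply/setP => q; apply/mulsgP/idP => [[_ _ /rcosetP[k kK ->] /quot_imageP[g <-] ->]|].
  rewrite -mulgA -quot_piM /edge_image -nus quot_piM mulgA mem_rcoset mulgK.
  have := quot_image_absorb (bd0 g) => <-.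
  by rewrite mem_rcoset mulgK.
move=> qK; exists q 1%g => //; last by rewrite mulg1.
exact: (group1 (quot_image_group U (edge_imageM Guniv (e := e)))).
Qed.

(* The boundary map R[E\Q] -> R[K\Q] of the tree of cosets, on all subsets. *)
Definition edge_boundary (e : edge Xi) (a : RS) : RS :=
  push (fun S : set_gset (quot U) =>
    ((K (d0 (val e)) :* quot_pi U (s e)) * S)%g : set_gset (quot U)) a
  - push (fun S : set_gset (quot U) =>
    (K (d1 (val e)) * S)%g : set_gset (quot U)) a.

Lemma edge_boundaryD e : {morph edge_boundary e : a b / a + b}.
Proof. by move=> a b; rewrite /edge_boundary !pushD opprD addrACA. Qed.

Lemma edge_boundary_act e a q : edge_boundary e (gact a q) = gact (edge_boundary e a) q.
Proof.
by rewrite /edge_boundary gactB !push_act // => S r /=; rewrite mulgA.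
Qed.

Lemma edge_boundary_delta e : edge_boundary e (dl (E e)) =
  dl (K (d0 (val e)) :* quot_pi U (s e))%g - dl (K (d1 (val e))).
Proof. by rewrite /edge_boundary !push_delta edge_absorb0 edge_absorb1. Qed.

Definition boundary_sum (v : vertex Xi) : RS :=
  \sum_e edge_boundary e (dl (E e)) *~ c e v.

(** Adding the coset [K v] gives a function of [v] that is constant along tree edges, where the
    stable letter is 1 and the boundary of [E e] is [K (d0 e) - K (d1 e)]. At [v0] all coefficients
    vanish. *)
Lemma boundary_sumE v : boundary_sum v = dl (K v0) - dl (K v).
Proof.
apply: (addIr (dl (K v))); rewrite subrK.
transitivity (boundary_sum v0 + dl (K v0)); last first.
  by rewrite /boundary_sum big1 ?add0r // => e _; rewrite c_v0.
apply: (connected_on_constant (x := fun v => boundary_sum v + dl (K v)) Theta_connected).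
move=> e eT; have [_ sT _ _ _] := Guniv.
have Z : boundary_sum (d1 (val e)) - boundary_sum (d0 (val e))
    = edge_boundary e (dl (E e)).
  rewrite -(sum_mulrn_eq (fun e' => edge_boundary e' (dl (E e')))) -sumrB.
  by apply: eq_bigr => e' _; rewrite -mulrzBr c_tree // mulrz_nat.
rewrite edge_boundary_delta sT // rcoset1 in Z.
have -> : boundary_sum (d1 (val e)) = dl (K (d0 (val e))) - dl (K (d1 (val e)))
    + boundary_sum (d0 (val e)) by rewrite -Z subrK.
by rewrite addrAC subrK addrC.
Qed.

Lemma edge_derivations_separate (f : edge Xi -> G -> RS) (g : G) :
    (1 : R) != 0 ->
    (forall e, edge_derivation nu s c e (dl (E e)) (f e)) ->
    (forall e, f e g = 0) -> quot_pi U g \in K v0.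
Proof.
move=> R1 fd fg.
pose D (h : G) : RS := \sum_e edge_boundary e (f e h).
(* Once [D = D0], vanishing at [g] says that right multiplication by [g] fixes the coset [K v0]. *)
pose D0 (h : G) : RS := gact (dl (K v0)) (quot_pi U h) - dl (K v0).
have bd e : edge_derivation nu s c e (edge_boundary e (dl (E e))) (edge_boundary e \o f e).
  apply: (edge_derivation_morph (edge_boundaryD e) _ (fd e)) => a h.
  exact: edge_boundary_act.
suff : D = D0.
  move=> /(congr1 (fun k => k g)); rewrite /D /D0 big1 => [|e _]; last first.
    by rewrite fg (additive_morph0 (edge_boundaryD e)).
  move=> /esym/eqP; rewrite subr_eq0 delta_act => /eqP/(delta_inj R1) /= <-.
  rewrite mem_rcoset mulgV.
  exact: (group1 (quot_image_group U (nuM v0))).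
apply: (quot_derivation_unique Guniv).
- by apply: quot_derivation_sum => e; have [] := bd e.
- exact: quot_derivation_inner.
- move=> v h; rewrite /D /D0.
  transitivity (gact (boundary_sum v) (quot_pi U (nu v h)) - boundary_sum v).
    rewrite /boundary_sum.
    rewrite (additive_morph_sum (@gactD _ RS _)) -sumrB; apply: eq_bigr => e _.
    by have [_ /(_ v h) /= -> _] := bd e.
  (* Of the two terms [K v0 - K v], the second is fixed by the image of the group at [v], so only
     [K v0] contributes. *)
  rewrite boundary_sumE gactB delta_act [X in _ - X - _]delta_act /= quot_image_absorb.
  by rewrite opprB addrA subrK.
- move=> e; rewrite /D /D0.
  transitivity (gact (boundary_sum (d0 (val e))) (quot_pi U (s e))
    - boundary_sum (d1 (val e)) + edge_boundary e (dl (E e))).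
    rewrite /boundary_sum.
    rewrite -(sum_mulrn_eq (fun e' => edge_boundary e' (dl (E e')))).
    rewrite (additive_morph_sum (@gactD _ RS _)) -sumrB -big_split /=.
    by apply: eq_bigr => e' _; have [_ _ /(_ e) /= ->] := bd e'.
  rewrite !boundary_sumE edge_boundary_delta gactB !delta_act.
  by rewrite opprB addrAC !addrA !subrK.
Qed.
End Separation.

(** * Edge group sums in the group algebras *)

Section EdgeSums.
Variables (Xi : finGraph) (GG : graphOfProfiniteGroups Xi) (Theta : {set Xi})
  (G : profiniteGroupType) (nu : forall v : vertex Xi, GG (val v) -> G)
  (s : edge Xi -> G).
Arguments nu : clear implicits.
Hypothesis Guniv : fundamental_universal Theta nu s.
Hypothesis GGfin : forall e : edge Xi, finite_set [set: GG (val e)].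
Variable R : finPzRingType.

Local Notation img e := (@edge_image Xi GG G nu e).
Local Notation E e U := (quot_image (img e) U).
Local Notation dl U S := (delta R (S : set_gset (quot U))).

(** The sum runs over elements of [G], with multiplicities in [G/U], which makes it compatible with
    the projections for every [U], even one meeting the edge group nontrivially. *)
Definition edge_sum (e : edge Xi) (U : openNormal G) :
    fun_gmodule R (translation_gset (quot U)) :=
  \sum_(h <- fset_set (range (img e))) delta R (quot_pi U h : translation_gset _).

Lemma edge_image_finite e : finite_set (range (img e)).
Proof. exact: finite_image. Qed.

Lemma mem_edge_image e x : reflect (range (img e) x) (x \in fset_set (range (img e))).
Proof.
by rewrite in_fset_set ?inE; [exact: asboolP|exact: edge_image_finite].
Qed.

(** Right multiplication by an element of the image of the edge group permutes the summands. *)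
Lemma edge_sum_invariant e (U : openNormal G) (g : GG (val e)) :
  gact (edge_sum e U) (quot_pi U (img e g)) = edge_sum e U.
Proof.
have [_ EM EV] := morphism_range_subgroup (edge_imageM Guniv (e := e)).
rewrite (additive_morph_sum (@gactD _ _ _)).
under eq_bigr do rewrite delta_act /= -quot_piM.
rewrite -(big_map (fun h => h * img e g)%g predT
  (fun h => delta R (quot_pi U h : translation_gset _))).
apply: perm_big; apply: uniq_perm; rewrite ?map_inj_uniq ?fset_uniq //.
  exact: mulIg.
move=> x; apply/mapP/mem_edge_image => [[h /mem_edge_image hE ->]|xE].
  by apply: EM => //; exists g.
exists (x * (img e g)^-1)%g; last by rewrite mulgVK.
by apply/mem_edge_image; apply: EM => //; apply: EV; exists g.
Qed.

Lemma edge_sum_coherent e (U V : openNormal G) : U `<=` V ->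
  galg_map (@quot_proj G U V) (edge_sum e U) = edge_sum e V.
Proof.
move=> UV; rewrite (additive_morph_sum (@galg_mapD R _ _ _)).
apply: eq_bigr => h _.
rewrite -(quot_projE h UV).
exact: (push_delta R (@quot_proj G U V : translation_gset _ -> translation_gset _)).
Qed.

(** When [U] meets the edge group trivially, all multiplicities are 1, so the edge sum is the
    indicator function of [E e U]. *)
Lemma edge_sum_pull e (U : openNormal G) :
    (forall x, open_normal_set U x -> range (img e) x -> x = 1%g) ->
  edge_sum e U = pull (fun q : translation_gset (quot U) =>
    (E e U :* q)%g : set_gset (quot U)) (dl U (E e U)).
Proof.
move=> Uinj; have [_ EM EV] := morphism_range_subgroup (edge_imageM Guniv (e := e)).
have qinj h h' : range (img e) h -> range (img e) h' ->
    quot_pi U h = quot_pi U h' -> h' = h.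
  move=> hE h'E /quot_eqP hU; apply: (mulgI h^-1%g); rewrite mulVg.
  by apply: Uinj => //; apply: EM => //; exact: EV.
pose Eg := quot_image_group U (edge_imageM Guniv (e := e)).
apply/ffunP => q; rewrite ffunE ffunE.
have evD : {morph (fun a : fun_gmodule R (translation_gset (quot U)) => a q) :
    a b / a + b} by move=> a b; rewrite ffunE.
rewrite (additive_morph_sum evD).
have -> : ((E e U :* q)%g == E e U) = (q \in E e U).
  apply/eqP/idP => [<-|qE]; first exact: (rcoset_refl Eg).
  exact: (@rcoset_id _ Eg).
case: quot_imageP => [[g <-]|nq]; last first.
  rewrite big_seq big1 // => h /mem_edge_image[g _ <-]; rewrite ffunE.
  by case: eqP => // qE; case: nq; exists g.
have gE : range (img e) (img e g) by exists g.
rewrite (bigD1_seq (img e g)) ?fset_uniq //=; last exact/mem_edge_image.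
rewrite ffunE eqxx big_seq_cond big1 ?addr0 // => h /andP[/mem_edge_image hE hg].
by rewrite ffunE; case: eqP => // /qinj hgE; rewrite hgE ?eqxx // in hg.
Qed.

Hypothesis Theta_connected : connected_on Theta.
Variable c : edge Xi -> vertex Xi -> int.
Hypothesis c_tree : forall e0 e : edge Xi, val e \in Theta ->
  c e0 (d1 (val e)) - c e0 (d0 (val e)) = (e == e0)%:R.
Variable v0 : vertex Xi.
Hypothesis c_v0 : forall e0, c e0 v0 = 0.

(** Both conditions define neighbourhoods of 1: [H] is closed, and the nontrivial elements of the
    finitely many finite edge groups form a closed set. *)
Lemma open_normal_separating (H : set G) (g : G) : closed H -> ~ H g ->
  exists U : openNormal G, (forall x, open_normal_set U x -> ~ H (g * x)%g) /\
    forall e x, open_normal_set U x -> range (img e) x -> x = 1%g.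
Proof.
move=> cH nHg.
pose A1 := [set x : G | ~ H (g * x)%g].
pose A2 := \bigcap_(e in [set: edge Xi]) ~` (range (img e) `\ 1%g).
have nA1 : nbhs 1%g A1.
  have cm : continuous (fun x : G => (g * x)%g).
    by apply: mul_continuous2 => x; [exact: cvg_cst|exact: cvg_id].
  apply: (cm 1%g (~` H)); rewrite mulg1; apply: open_nbhs_nbhs; split=> //.
  exact: closed_openC.
have nA2 : nbhs 1%g A2.
  apply: open_nbhs_nbhs; split; last by move=> e _ [_ /(_ erefl)].
  rewrite /A2 -setC_bigcup; apply: closed_openC; apply: closed_bigcup => [|e _].
    exact: finite_finset.
  apply: compact_closed; first exact: profinite_hausdorff.
  by apply: finite_compact; apply: finite_setD; exact: edge_image_finite.
have [U UA] := open_normal_base (filterI nA1 nA2).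
exists U; split=> [x /UA[]//|e x /UA[_ /(_ e I) xA] xE].
by apply: contrapT => x1; apply: xA.
Qed.

(** For a [U] separating [g], vanishing in [R[Q]] is carried back to the coset module along the
    injection of [R[E\Q]], and then separation applies. *)
Lemma edge_derivations_kernel (g : G) : (1 : R) != 0 -> closed (range (nu v0)) ->
    (forall e U f, edge_derivation nu s c e (edge_sum e U) f -> f g = 0) ->
  range (nu v0) g.
Proof.
move=> R1 cH fg; apply: contrapT => /(open_normal_separating cH)[U [UH UE]].
have ex e : exists f, edge_derivation nu s c e (dl U (E e U)) f.
  apply: (edge_derivation_exists Guniv c_tree) => h; rewrite delta_act.
  apply: (congr1 (fun S => dl U S)).
  apply: (@rcoset_id _ (quot_image_group U (edge_imageM Guniv (e := e)))).
  exact: mem_quot_image.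
have /choice[f fE] := ex.
have f0 e : f e g = 0.
  pose Eg := quot_image_group U (edge_imageM Guniv (e := e)).
  pose P : pred (set_gset (quot U)) := fun S => S \in rcosets (E e U) [set: quot U]%SET.
  have PQ (S : set_gset (quot U)) q : P (gset_act S q) = P S.
    apply/rcosetsP/rcosetsP => -[r _ h].
      exists (r * q^-1)%g; rewrite ?inE // rcosetM -h.
      by rewrite -rcosetM mulgV rcoset1.
    by exists (r * q)%g; rewrite ?inE //= h rcosetM.
  have PE : P (E e U) by apply/rcosetsP; exists 1%g; rewrite ?inE ?rcoset1.
  (* The values of [f e] are supported on cosets of [E e U]: restricting to them fixes the
     generator, hence the derivation. *)
  have fr : restriction P \o f e = f e.
    apply: (edge_derivation_unique Guniv _ (fE e)).
    rewrite -[X in edge_derivation _ _ _ _ X](restriction_delta R PE).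
    apply: edge_derivation_morph (fE e); first exact: restrictionD.
    by move=> a h; exact: restriction_act.
  pose th := fun q : translation_gset (quot U) => (E e U :* q)%g : set_gset (quot U).
  have thf : edge_derivation nu s c e (edge_sum e U) (pull (R := R) th \o f e).
    rewrite edge_sum_pull; last exact: UE.
    apply: edge_derivation_morph (fE e); first exact: pullD.
    by move=> a h; apply: pull_act => q r; exact: rcosetM.
  have /ffunP thfg := fg _ _ _ thf.
  (* The coefficient at a coset [E q] is the coefficient of the pulled back function at [q], which
     is 0. *)
  rewrite -fr; apply/ffunP => S; rewrite !ffunE /P.
  case: ifP => // /rcosetsP[q _ ->].
  by have := thfg q; rewrite !ffunE.
have /quot_imageP[a ag] :=
  edge_derivations_separate Guniv Theta_connected c_tree c_v0 R1 fE f0.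
have /quot_eqP Ux := esym ag.
by apply: (UH _ Ux); exists a => //; rewrite mulgA mulgV mul1g.
Qed.

End EdgeSums.

(** * Continuity and assembly of the derivation *)

(** The inverse limit carries the initial topology for its coordinates in the discrete modules
    [R[G/U]]. *)
Lemma completed_group_algebra_continuous (R : finPzRingType) (G : profiniteGroupType)
    (T : topologicalType) (f : T -> completed_group_algebra R G) :
  (forall U, locally_constant (fun x => cga_coef (f x) U)) -> continuous f.
Proof.
move=> fc; apply: continuous_comp_initial => x.
apply/cvg_sup => U.
apply: (@continuous_comp_initial _ T (discrete_topology (group_algebra R (quot U)))
  (fun a : galg_prod R G => a U) (fun x => set_val (f x))).
exact: (iffRL (@locally_constant_continuous T (group_algebra R (quot U)) _) (fc U)).
Qed.

Lemma row_continuous (T S : topologicalType) n (F : T -> 'rV[S]_n) :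
  (forall i, continuous (fun x => F x 0 i)) -> continuous F.
Proof.
move=> Fc x A [P nP PA].
have : \forall y \near x, forall i, P 0 i (F y 0 i).
  by apply: filter_forall => i; exact: Fc.
by apply: filterS => y Py; apply: PA => i j; rewrite ord1.
Qed.

Theorem theorem1p1 (G : profiniteGroupType) (H : set G)
  (Hsub : subgroup H) (Hclosed : closed H)
  (Xi : finGraph) (GG : graphOfProfiniteGroups Xi) (Theta : {set Xi})
  (Hacc : accessible_via GG Theta H)
  (n : nat) (Hn : #|edges Xi| = n :> nat)
  (R : finPzRingType)
  (HR : forall e : edge Xi,
     ~~ (characteristic R %| group_order (GG (val e)))%N) :
  exists f : G -> 'rV[completed_group_algebra R G]_n,
    [/\ derivation (@cga_row_mulr R G n) f,
        continuous f
      & derivation_ker f = H].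
Proof.
have [_ [_ Tconn acyc] GGfin [nu /fundamental_groupP[s Guniv] [v0 HE]]] := Hacc.
have /choice[c cP] : forall e0 : edge Xi, exists c : vertex Xi -> int,
    (forall e : edge Xi, val e \in Theta ->
      c (d1 (val e)) - c (d0 (val e)) = (e == e0)%:R) /\ c v0 = 0.
  move=> e0; have [x xE] := forest_potential (fun e => (e == e0)%:R : int) acyc.
  (* Subtracting a constant keeps the differences and normalizes the potential to 0 at [v0]. *)
  exists (fun v => x v - x v0); split; last exact: subrr.
  by move=> e eT; rewrite opprB addrA subrK xE.
have c_tree e0 e eT := (cP e0).1 e eT.
have c_v0 e0 := (cP e0).2.
have ex e U := edge_derivation_exists Guniv c_tree
  (edge_sum_invariant Guniv GGfin R (e := e) U).
pose f e U := projT1 (cid (ex e U)).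
have fE e U : edge_derivation nu s c e (edge_sum nu R e U) (f e U) := projT2 (cid (ex e U)).
have coh e g (U V : openNormal G) : U `<=` V ->
    galg_map (@quot_proj G U V) (f e U g) = f e V g.
  (* Projecting the derivation at level [U] gives an edge derivation at level [V] for the projected
     edge sum, so uniqueness applies. *)
  move=> UV; suff : galg_map (@quot_proj G U V) \o f e U = f e V by move/(congr1 (@^~ g)).
  apply: (edge_derivation_unique Guniv _ (fE e V)).
  rewrite -(edge_sum_coherent nu R e UV).
  apply: edge_derivation_morph (fE e U); first exact: galg_mapD.
  move=> a h; rewrite -(quot_projE h UV).
  by apply: galg_map_mulr; exact: quot_projM.
have cardE : n = #|edge Xi| by rewrite card_sig -Hn; apply: eq_card => e.
pose F g : 'rV[completed_group_algebra R G]_n :=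
  \row_i cga_of (coh (enum_val (cast_ord cardE i)) g).
have F0 g : F g = 0 <-> forall e U, f e U g = 0.
  split=> [/rowP Fg e U|fg].
    have := Fg (cast_ord (esym cardE) (enum_rank e)).
    rewrite !mxE cast_ordKV enum_rankK => /(congr1 (fun a => cga_coef a U)).
    exact.
  by apply/rowP => i; rewrite !mxE; apply: cga_coef_inj => U; exact: fg.
exists F; split.
- move=> g h; apply/rowP => i; rewrite !mxE; apply: cga_coef_inj => U.
  by have [[fM _] _ _] := fE (enum_val (cast_ord cardE i)) U; exact: fM.
- apply: row_continuous => i; apply: completed_group_algebra_continuous => U.
  have [[_ fc] _ _] := fE (enum_val (cast_ord cardE i)) U.
  have -> // : (fun g => cga_coef (F g 0 i) U) = f (enum_val (cast_ord cardE i)) U.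
  by apply/funext => g; rewrite mxE.
- apply/seteqP; split=> g; last first.
    (* On the group at [v0] each coordinate is the inner derivation of [c e v0] times the edge sum,
       which is 0. *)
    rewrite HE => -[h _ <-]; apply/F0 => e U.
    have [_ -> _] := fE e U; rewrite c_v0 mulr0z.
    by rewrite gact0 subrr.
  move=> /F0 fg; rewrite HE in Hclosed *.
  have [R0|R1] := eqVneq (1 : R) 0; last first.
    apply: (edge_derivations_kernel Guniv GGfin Tconn c_tree c_v0 R1 Hclosed).
    by move=> e U f' f'E; rewrite (edge_derivation_unique Guniv f'E (fE e U)).
  (* If R = 0, then there are no edges, and any nonzero ring will do. *)
  apply: (edge_derivations_kernel (R := 'F_2) Guniv GGfin Tconn c_tree c_v0) => //.
  move=> e; have /negP[] := HR e.
  by rewrite dvdn_characteristic -mulr_natr R0 mul0r.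
Qed.
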